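(* Let $G$ be a finite group and $P$ a collection of primes. The localization maps $A(-)_{(P)} \to A(-)_{(P)}[e_L^{-1}]$ assemble into an isomorphism of $\mathcal{I}$-Tambara functors \[ A(-)_{(P)} \to \prod_{(L) \leq G\ P\text{-perfect}} A(-)_{(P)}[e_L^{-1}], \] where the product is over conjugacy classes of $P$-perfect subgroups of $G$ and $\mathcal{I}=\bigcap_{(L)\leq G}\mathcal{I}_L$.
   Context: $\mathbb{Z}_{(P)}=\mathbb{Z}[p^{-1}\mid p\notin P]$; for $H\leq G$, $A(H)$ is the Burnside ring of finite $H$-sets and $A(H)_{(P)}=A(H)\otimes\mathbb{Z}_{(P)}$. $A(-)_{(P)}$ is a Tambara functor with restrictions $R^H_K$, transfers $T_K^H$ and norms $N_K^H$ extending restriction, induction and co-induction $X\mapsto\mathrm{Map}_K(H,X)$ of finite sets. For $Q\leq G$ the mark $\phi^Q\colon A(G)_{(P)}\to\mathbb{Z}_{(P)}$ is the ring homomorphism with $\phi^Q([S])=|S^Q|$. For a finite group $Q$, $O^P(Q)$ is the unique minimal normal subgroup such that $Q/O^P(Q)$ is a solvable group whose order is divisible only by primes in $P$; $Q$ is $P$-perfect if $Q=O^P(Q)$. By Dress, conjugacy classes of $P$-perfect subgroups $L\le G$ correspond bijectively to primitive idempotents $e_L\in A(G)_{(P)}$, where $\phi^Q(e_L)=1$ if $O^P(Q)$ is conjugate in $G$ to $L$, and $0$ otherwise. $A(-)_{(P)}[e_L^{-1}]$ is the levelwise localization, with value $A(H)_{(P)}[R^G_H(e_L)^{-1}]$ at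 $H\leq G$. Indexing system: a contravariant functor $G/H\mapsto\mathcal{J}(H)$ from the orbit category of $G$ to symmetric monoidal categories and strong symmetric monoidal functors, a subfunctor of $G/H\mapsto \mathcal{S}et^H$ (finite $H$-sets under disjoint union), with $\mathcal{J}(H)$ a full symmetric monoidal subcategory of $\mathcal{S}et^H$ containing all trivial $H$-sets and closed under finite limits, such that $H/K\in\mathcal{J}(H)$ and $T\in\mathcal{J}(K)$ imply $H\times_K T\in\mathcal{J}(H)$. $\mathcal{I}_L$ is the indexing system for which a finite $H$-set lies in $\mathcal{I}_L(H)$ iff each of its orbits is isomorphic to some $H/K$ such that every $L'\leq H$ conjugate in $G$ to $L$ is contained in $K$. $\mathcal{I}$ is the levelwise intersection of the $\mathcal{I}_L$ over all conjugacy classes of $P$-perfect subgroups $L\leq G$, which is again an indexing system. Incomplete Tambara functors: the category of bispans has as objects finite $G$-sets and as morphisms isomorphism classes of diagrams $X\leftarrow Y\to Z\to W$ of finite $G$-sets (encoding a restriction, then a norm, then a transfer), with the usual composition used to define Tambara functors. For an indexing system $\mathcal{J}$, the bispans whose middle map $f\colon Y\to Z$ satisfies $G_{f(y)}/G_y\in\mathcal{J}(G_{f(y)})$ for all $y\in Y$ form a subcategory. A $\mathcal{J}$-Tambara functor is a product-preserving functor from this subcategory to sets whose values are abelian groups under the addition induced by transfers along fold maps; morphisms are natural transformations. $A(-)_{(P)}$ is an $\mathcal{I}$-Tambara functor by forgetting norms. Each $A(-)_{(P)}[e_L^{-1}]$ is an $\mathcal{I}_L$-Tambara functor with norms inherited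 from $A(-)_{(P)}$ (determined by compatibility with the localization map), hence an $\mathcal{I}$-Tambara functor by forgetting structure. *)

(* Defs.v *)
From mathcomp Require Import all_boot all_order all_algebra all_fingroup all_solvable.
From Stdlib Require Import FunctionalExtensionality.

Set Implicit Arguments.
Unset Strict Implicit.
Unset Printing Implicit Defensive.

Import GroupScope.

(* Following the library, groups act on the right.  Thus the orbit H/K is the *)
(* set of right cosets of K in H, and a finite H-set is a finType with an     *)
(* action of domain H (what elements outside of H do is irrelevant).          *)
(* The ambient finite group is the whole of gT.                               *)

Section HSets.
Variable gT : finGroupType.
Implicit Types H K : {group gT}.

Record hset H := HSet { hcar :> finType; hact : action H hcar }.

Record hmap H (X Y : hset H) := HMap {
  hfun :> X -> Y;
  hmapP : {in H, forall a, forall x : X,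
             hfun (hact X x a) = hact Y (hfun x) a} }.

Definition hisomorphic H (X Y : hset H) := exists f : hmap X Y, bijective f.

Definition hextend H (T : Type) (f : T -> gT -> T) (x : T) (a : gT) :=
  if a \in H then f x a else x.

Lemma hextend_action H (T : Type) (f : T -> gT -> T) :
    (forall x, f x 1 = x) ->
    {in H &, forall a b, forall x, f x (a * b) = f (f x a) b} ->
  is_action H (hextend H f).
Proof.
move=> f1 fM; split=> [a x y|x a b aH bH]; rewrite /hextend.
  case: ifP => // aH e; rewrite -(f1 x) -(f1 y) -(mulgV a).
  by rewrite !fM ?groupV // e.
by rewrite groupM // aH bH fM.
Qed.

Definition mkhset H (T : finType) (f : T -> gT -> T)
    (f1 : forall x, f x 1 = x)
    (fM : {in H &, forall a b, forall x, f x (a * b) = f (f x a) b}) : hset H :=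
  HSet (Action (hextend_action f1 fM)).

Lemma mkhsetE H T f f1 fM a x : a \in H -> hact (@mkhset H T f f1 fM) x a = f x a.
Proof. by move=> aH; rewrite /= /hextend aH. Qed.

Lemma hact1 H (X : hset H) x : hact X x 1 = x.
Proof. exact: act1. Qed.

Lemma hactM H (X : hset H) :
  {in H &, forall a b, forall x, hact X x (a * b) = hact X (hact X x a) b}.
Proof. by move=> a b aH bH x; exact: actMin. Qed.

Lemma hactK H (X : hset H) a x : a \in H -> hact X (hact X x a) a^-1 = x.
Proof. by move=> aH; rewrite -hactM ?groupV // mulgV hact1. Qed.

Lemma hactKV H (X : hset H) a x : a \in H -> hact X (hact X x a^-1) a = x.
Proof. by move=> aH; rewrite -hactM ?groupV // mulVg hact1. Qed.

Definition hid H (X : hset H) : hmap X X := @HMap H X X id (fun _ _ _ => erefl).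

Definition hcomp H (X Y Z : hset H) (g : hmap Y Z) (f : hmap X Y) : hmap X Z.
Proof.
exists (g \o f) => a aH x /=.
by rewrite !hmapP.
Defined.

Lemma triv_is_action H (T : finType) : is_action H (fun (x : T) (_ : gT) => x).
Proof. by split=> [a x y|x a b]. Qed.

Definition htriv H (T : finType) : hset H := HSet (Action (triv_is_action H T)).
Definition hempty H : hset H := htriv H void.
Definition hpoint H : hset H := htriv H unit.

Definition hfrom_empty H (X : hset H) : hmap (hempty H) X :=
  @HMap H (hempty H) X (fun x => match x with end)
    (fun _ _ x => match x with end).

Definition hto_point H (X : hset H) : hmap X (hpoint H) :=
  @HMap H X (hpoint H) (fun _ => tt) (fun _ _ _ => erefl).

Definition sum_act H (X Y : hset H) (u : X + Y) (a : gT) : X + Y :=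
  match u with inl x => inl (hact X x a) | inr y => inr (hact Y y a) end.

Lemma sum_is_action H (X Y : hset H) : is_action H (@sum_act H X Y).
Proof.
split=> [a [x|y] [x'|y'] //= [] /act_inj -> // | [x|y] a b aH bH /=];
  by rewrite hactM.
Qed.

Definition hsum H (X Y : hset H) : hset H := HSet (Action (sum_is_action X Y)).

Definition hinl H (X Y : hset H) : hmap X (hsum X Y) :=
  @HMap H X (hsum X Y) inl (fun _ _ _ => erefl).
Definition hinr H (X Y : hset H) : hmap Y (hsum X Y) :=
  @HMap H Y (hsum X Y) inr (fun _ _ _ => erefl).

Definition hcase H (X Y Z : hset H) (f : hmap X Z) (g : hmap Y Z) :
  hmap (hsum X Y) Z.
Proof.
exists (fun u => match u with inl x => f x | inr y => g y end).
by move=> a aH [x|y] /=; rewrite hmapP.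
Defined.

Definition hfold H (X : hset H) : hmap (hsum X X) X := hcase (hid X) (hid X).

Section Sub.
Variables (H : {group gT}) (X : hset H) (A : pred X).
Hypothesis Ainv : {in H, forall a, forall x, A x -> A (hact X x a)}.

Definition sub_act (u : {x | A x}) (a : gT) : {x | A x} :=
  insubd u (hact X (val u) a).

Lemma val_sub_act u a : a \in H -> val (sub_act u a) = hact X (val u) a.
Proof. by move=> aH; rewrite val_insubd Ainv ?(valP u). Qed.

Lemma sub_act1 u : sub_act u 1 = u.
Proof. by apply: val_inj; rewrite val_sub_act // hact1. Qed.

Lemma sub_actM :
  {in H &, forall a b, forall u, sub_act u (a * b) = sub_act (sub_act u a) b}.
Proof.
move=> a b aH bH u; apply: val_inj.
by rewrite !val_sub_act ?groupM // hactM.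
Qed.

Definition hsub : hset H := mkhset sub_act1 sub_actM.

Lemma val_hsub (u : hsub) a : a \in H -> val (hact hsub u a) = hact X (val u) a.
Proof. by move=> aH; rewrite mkhsetE // val_sub_act. Qed.

Definition hsub_pt (x : X) (Ax : A x) : hsub := exist _ x Ax.

Definition hval : hmap hsub X := @HMap H hsub X val
  (fun a aH u => val_hsub u aH).
End Sub.

Lemma orbit_inv H (X : hset H) (x : X) :
  {in H, forall a, forall y, (y \in orbit (hact X) H x) ->
     (hact X y a \in orbit (hact X) H x)}.
Proof.
move=> a aH y /imsetP[b bH ->]; apply/imsetP; exists (b * a); first exact: groupM.
by rewrite hactM.
Qed.

Definition horbit H (X : hset H) (x : X) : hset H := hsub (@orbit_inv H X x).

(* The orbit H/K, meant for K \subset H. *)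

Lemma rcosets_inv H K :
  {in H, forall a, forall c : {set gT}, (c \in rcosets K H) ->
     (c :* a \in rcosets K H)}.
Proof.
move=> a aH c /rcosetsP[b bH ->]; rewrite -rcosetM.
by apply/rcosetsP; exists (b * a); rewrite ?groupM.
Qed.

Definition hright H : hset H :=
  @mkhset H {set gT} (fun c a => c :* a) (@rcoset1 gT)
    (fun a b _ _ c => rcosetM c a b).

Lemma hright_inv H K :
  {in H, forall a, forall c : hright H, (c \in rcosets K H) ->
     (hact (hright H) c a \in rcosets K H)}.
Proof. by move=> a aH c cK; rewrite mkhsetE // rcosets_inv. Qed.

Definition hcoset H K : hset H := hsub (@hright_inv H K).

(* Products, and pullbacks as invariant subsets of products. *)

Lemma prod_act1 H (X Y : hset H) (p : X * Y) :
  (hact X p.1 1, hact Y p.2 1) = p.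
Proof. by case: p => x y; rewrite !hact1. Qed.

Lemma prod_actM H (X Y : hset H) : {in H &, forall a b, forall p : X * Y,
  (hact X p.1 (a * b), hact Y p.2 (a * b)) =
  (hact X (hact X p.1 a) b, hact Y (hact Y p.2 a) b)}.
Proof. by move=> a b aH bH p; rewrite !hactM. Qed.

Definition hprod H (X Y : hset H) : hset H :=
  @mkhset H (X * Y)%type (fun p a => (hact X p.1 a, hact Y p.2 a))
    (@prod_act1 H X Y) (@prod_actM H X Y).

Definition hfst H (X Y : hset H) : hmap (hprod X Y) X.
Proof. by exists fst => a aH p; rewrite mkhsetE. Defined.

Definition hsnd H (X Y : hset H) : hmap (hprod X Y) Y.
Proof. by exists snd => a aH p; rewrite mkhsetE. Defined.

Section Pullback.
Variables (H : {group gT}) (X Y Z : hset H) (f : hmap X Z) (g : hmap Y Z).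

Lemma pull_inv : {in H, forall a, forall p : hprod X Y,
  (f p.1 == g p.2) ->
  (f (hact (hprod X Y) p a).1 == g (hact (hprod X Y) p a).2)}.
Proof. by move=> a aH p /eqP e; rewrite mkhsetE //= !hmapP // e. Qed.

Definition hpull : hset H := hsub pull_inv.
Definition hpull1 : hmap hpull X := hcomp (hfst X Y) (hval pull_inv).
Definition hpull2 : hmap hpull Y := hcomp (hsnd X Y) (hval pull_inv).
End Pullback.

(* The dependent product of q : Q -> Y along g : Y -> Z, with its projection  *)
(* to Z: the points over z are the pairs (z, s) with s a section of q over    *)
(* the fibre of g at z, encoded as a partial function defined on that fibre.  *)

Section DepProd.
Variables (H : {group gT}) (Q Y Z : hset H) (g : hmap Y Z) (q : hmap Q Y).

Definition sec_act (s : {ffun Y -> option Q}) (a : gT) : {ffun Y -> option Q} :=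
  [ffun y => omap (fun c => hact Q c a) (s (hact Y y a^-1))].

Lemma sec_act1 s : sec_act s 1 = s.
Proof.
apply/ffunP=> y; rewrite ffunE invg1 hact1.
by case: (s y) => //= c; rewrite hact1.
Qed.

Lemma sec_actM :
  {in H &, forall a b, forall s, sec_act s (a * b) = sec_act (sec_act s a) b}.
Proof.
move=> a b aH bH s; apply/ffunP=> y.
rewrite !ffunE invMg hactM ?groupV //.
by case: (s _) => //= c; rewrite hactM.
Qed.

Definition hsec : hset H := mkhset sec_act1 sec_actM.

Definition is_section (p : hprod Z hsec) : bool :=
  [forall y : Y, match (p.2 : {ffun Y -> option Q}) y with
                 | Some c => (q c == y) && (g y == p.1)
                 | None => g y != p.1
                 end].

Lemma section_inv : {in H, forall a, forall p,
  is_section p -> is_section (hact (hprod Z hsec) p a)}.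
Proof.
move=> a aH [z s] /forallP ps; apply/forallP=> y; rewrite mkhsetE //=.
rewrite /hextend aH /sec_act ffunE.
have inj : forall y', (g y' == hact Z z a) = (g (hact Y y' a^-1) == z).
  by move=> y'; rewrite hmapP ?groupV //; apply/eqP/eqP=> [->|<-];
     rewrite ?hactK ?hactKV.
move: (ps (hact Y y a^-1)) => /=; case: (s _) => [c|] /=; rewrite inj //.
by case/andP=> /eqP e ->; rewrite hmapP // e hactKV // eqxx.
Qed.

Definition hdprod : hset H := hsub section_inv.
Definition hdproj : hmap hdprod Z := hcomp (hfst Z hsec) (hval section_inv).

(* The evaluation map Y x_Z hdprod -> Q over Y. *)

Lemma ev_some (w : hpull g hdproj) :
  isSome (((val (val w).2).2 : {ffun Y -> option Q}) (val w).1).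
Proof.
case: w => [[y [[z s] /= ps]]] /=; rewrite /= => /eqP e.
by move/forallP: ps => /(_ y) /=; case: (s y) => //; rewrite e eqxx.
Qed.

Definition ev_fun (w : hpull g hdproj) : Q :=
  match ((val (val w).2).2 : {ffun Y -> option Q}) (val w).1
    as o return isSome o -> Q with
  | Some c => fun=> c
  | None => fun F => False_rect Q (notF F)
  end (ev_some w).

Lemma ev_funE w :
  Some (ev_fun w) = ((val (val w).2).2 : {ffun Y -> option Q}) (val w).1.
Proof. by rewrite /ev_fun; move: (ev_some w); case: (_ (val w).1). Qed.

Lemma ev_inv : {in H, forall a, forall w,
  ev_fun (hact (hpull g hdproj) w a) = hact Q (ev_fun w) a}.
Proof.
move=> a aH w; apply: Some_inj; rewrite ev_funE.
have -> : val (hact (hpull g hdproj) w a)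
          = (hact Y (val w).1 a, hact hdprod (val w).2 a).
  by rewrite val_hsub // mkhsetE.
have -> : val (hact hdprod (val w).2 a)
          = (hact Z (val (val w).2).1 a, hact hsec (val (val w).2).2 a).
  by rewrite val_hsub // mkhsetE.
by rewrite [hact hsec _ a]mkhsetE // ffunE hactK // -ev_funE.
Qed.

Definition hev : hmap (hpull g hdproj) Q := HMap ev_inv.
End DepProd.

(* Restriction along conjugation by x, K -> H for K :^ x \subset H; this is   *)
(* the functoriality of H |-> Set^H in maps G/K -> G/H of the orbit category. *)

Section Restriction.
Variables (H K : {group gT}) (x : gT).
Hypothesis sKH : K :^ x \subset H.

Lemma res_mem k : k \in K -> k ^ x \in H.
Proof. by move=> kK; apply: (subsetP sKH); rewrite memJ_conjg. Qed.

Lemma res_actM (T : hset H) : {in K &, forall a b, forall t,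
  hact T t ((a * b) ^ x) = hact T (hact T t (a ^ x)) (b ^ x)}.
Proof. by move=> a b aK bK t; rewrite conjMg hactM ?res_mem. Qed.

Lemma res_act1 (T : hset H) t : hact T t (1 ^ x) = t.
Proof. by rewrite conj1g hact1. Qed.

Definition hres (T : hset H) : hset K :=
  @mkhset K T (fun t a => hact T t (a ^ x)) (@res_act1 T) (@res_actM T).
End Restriction.

(* Induction T x_K H of a K-set T, for K \subset H: the quotient of T x H by  *)
(* (t k, h) ~ (t, k h), elements being represented by equivalence classes.    *)

Section Induction.
Variables (H K : {group gT}) (T : hset K).

Definition ind_class (t : T) (h : gT) : {set T * gT} :=
  [set (hact T t k, k^-1 * h) | k in K].

Definition ind_act (O : {set T * gT}) (a : gT) : {set T * gT} :=
  [set (u.1, u.2 * a) | u in O].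

Lemma ind_act1 O : ind_act O 1 = O.
Proof.
rewrite -[RHS]imset_id; apply: eq_imset => -[t h] /=.
by rewrite mulg1.
Qed.

Lemma ind_actM :
  {in H &, forall a b, forall O, ind_act O (a * b) = ind_act (ind_act O a) b}.
Proof.
move=> a b _ _ O; rewrite /ind_act -imset_comp; apply: eq_imset => -[t h] /=.
by rewrite mulgA.
Qed.

Definition hindset : hset H := mkhset ind_act1 ind_actM.

Lemma ind_act_class t h a : ind_act (ind_class t h) a = ind_class t (h * a).
Proof.
by rewrite /ind_act /ind_class -imset_comp; apply: eq_imset => k /=; rewrite mulgA.
Qed.

Definition is_ind_class (O : hindset) : bool :=
  [exists t : T, exists h in H, O == ind_class t h].

Lemma ind_inv : {in H, forall a, forall O,
  is_ind_class O -> is_ind_class (hact hindset O a)}.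
Proof.
move=> a aH O /existsP[t /existsP[h /andP[hH /eqP ->]]].
apply/existsP; exists t; apply/existsP; exists (h * a).
by rewrite groupM // mkhsetE // ind_act_class eqxx.
Qed.

Definition hind : hset H := hsub ind_inv.
End Induction.

End HSets.

Section IndexingSystems.
Variable gT : finGroupType.
Implicit Types H K : {group gT}.

(* A full replete subcategory J(H) of Set^H for each H; the terminal H-set    *)
(* being trivial, closure under pullbacks is closure under finite limits.     *)

Record indexing_system := IndexingSystem {
  adm :> forall H, hset H -> Prop;
  adm_iso : forall H (X Y : hset H), hisomorphic X Y -> adm X -> adm Y;
  adm_res : forall H K x (sKH : K :^ x \subset H) (T : hset H),
    adm T -> adm (hres sKH T);
  adm_triv : forall H (T : finType), adm (htriv H T);
  adm_sum : forall H (X Y : hset H), adm X -> adm Y -> adm (hsum X Y);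
  adm_pull : forall H (X Y Z : hset H) (f : hmap X Z) (g : hmap Y Z),
    adm X -> adm Y -> adm Z -> adm (hpull f g);
  adm_ind : forall H K (T : hset K), K \subset H ->
    adm (hcoset H K) -> adm T -> adm (hind H T) }.

Definition hstab H (X : hset H) (x : X) : {group gT} := 'C[x | hact X]%G.

Lemma hstabP H (X : hset H) (x : X) a :
  reflect (a \in H /\ hact X x a = x) (a \in hstab x).
Proof.
apply: (iffP idP) => [xa|[aH e]].
  have aH := astab_dom xa; split=> //.
  by apply: (astab_act xa); rewrite inE.
rewrite inE aH inE; apply/subsetP=> y; rewrite !inE => /eqP ->.
by rewrite e.
Qed.

Lemma hstab_sub H (X : hset H) (x : X) : hstab x \subset H.
Proof. by apply/subsetP=> a /hstabP[]. Qed.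

Lemma hmap_inv H (X Y : hset H) (f : hmap X Y) g : cancel f g -> cancel g f ->
  {in H, forall a, forall y, g (hact Y y a) = hact X (g y) a}.
Proof. by move=> fK gK a aH y; rewrite -{1}(gK y) -hmapP // fK. Qed.

Lemma hiso_sym H (X Y : hset H) : hisomorphic X Y -> hisomorphic Y X.
Proof.
case=> f [g fK gK]; exists (HMap (hmap_inv fK gK)); exact: Bijective gK fK.
Qed.

Section CosetIso.
Variables (H : {group gT}) (X : hset H) (x : X).
Hypothesis trX : forall y, exists2 a, a \in H & y = hact X x a.

Lemma move_coset y : amove (hact X) H x y \in rcosets (hstab x) H.
Proof.
have [a aH ->] := trX y; rewrite amove_act //.
have -> : 'C_H[x | hact X] = hstab x by apply/setIidPr; exact: hstab_sub.
by apply/rcosetsP; exists a.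
Qed.

Definition move_fun (y : X) : hcoset H (hstab x) := @hsub_pt _ _ (hright H) _ (@hright_inv _ H _) _ (move_coset y).

Lemma move_inv : {in H, forall a, forall y,
  move_fun (hact X y a) = hact (hcoset H (hstab x)) (move_fun y) a}.
Proof.
move=> a aH y; apply: val_inj; rewrite val_hsub // mkhsetE //=.
have [b bH ->] := trX y; rewrite -hactM // !amove_act ?groupM //.
by rewrite rcosetM.
Qed.

Lemma coset_iso : hisomorphic (hcoset H (hstab x)) X.
Proof.
apply: hiso_sym; exists (HMap move_inv) => /=.
exists (fun c => hact X x (repr (val c))) => [y|c] /=.
  have : repr (amove (hact X) H x y) \in amove (hact X) H x y.
    by have [a aH ->] := trX y; rewrite amove_act //; apply: mem_repr_rcoset.
  by rewrite !inE => /andP[_ /eqP].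
apply: val_inj => /=; case/rcosetsP: (valP c) => b bH ->.
have rH : repr (hstab x :* b) \in H.
  have : repr (hstab x :* b) \in hstab x :* b by apply: mem_repr_rcoset.
  case/rcosetP=> s sS ->; rewrite groupM //.
  exact: (subsetP (hstab_sub x)).
rewrite amove_act //.
have -> : 'C_H[x | hact X] = hstab x by apply/setIidPr; exact: hstab_sub.
by rewrite rcoset_repr.
Qed.
End CosetIso.

Lemma adm_sub (J : indexing_system) H (X : hset H) (A : pred X)
    (Ai : {in H, forall a, forall x, A x -> A (hact X x a)}) :
  J H X -> J H (hsub Ai).
Proof.
move=> JX.
have fP : {in H, forall a, forall x : X,
    (A (hact X x a) : htriv H bool) = hact (htriv H bool) (A x) a}.
  move=> a aH x /=; apply/idP/idP; last exact: Ai.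
  by move/(Ai _ (groupVr aH)); rewrite hactK.
pose f : hmap X (htriv H bool) := HMap fP.
pose g : hmap (hpoint H) (htriv H bool) :=
  @HMap _ H (hpoint H) (htriv H bool) (fun _ => true) (fun _ _ _ => erefl).
apply: adm_iso (adm_pull f g JX (adm_triv J H unit) (adm_triv J H bool)).
apply: hiso_sym.
have eA (u : hsub Ai) : f (val u) == g tt by apply/eqP; exact: (valP u).
pose k (u : hsub Ai) : hpull f g := exist _ (val u, tt) (eA u).
have kP : {in H, forall a, forall u, k (hact _ u a) = hact _ (k u) a}.
  by move=> a aH u; apply: val_inj; rewrite [RHS]val_hsub // [RHS]mkhsetE //; apply: (congr1 (pair^~ tt)); exact: val_hsub.
exists (HMap kP).
have hA (w : hpull f g) : A (val w).1 by have /eqP := valP w.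
exists (fun w => @hsub_pt _ H X A Ai _ (hA w)) => [u|w]; apply: val_inj => //=.
by case: w => [[y []] ?].
Qed.

(* Maps f : Y -> Z with G_f(y)/G_y in J(G_f(y)) for all y. *)

Definition gset := hset [set: gT]%G.
Definition gmap (X Y : gset) := hmap X Y.

Definition adm_map (J : indexing_system) (Y Z : gset) (f : gmap Y Z) : Prop :=
  forall y, J (hstab (f y)) (hcoset (hstab (f y)) (hstab y)).

Lemma hstab_map H (Y Z : hset H) (f : hmap Y Z) y : hstab y \subset hstab (f y).
Proof.
apply/subsetP=> a /hstabP[aH e]; apply/hstabP; split=> //.
by rewrite -hmapP // e.
Qed.

Lemma adm_map_stab (J : indexing_system) (Y Z : gset) (f : gmap Y Z) :
  (forall y, hstab (f y) = hstab y) -> adm_map J f.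
Proof.
move=> e y; rewrite e; apply: adm_iso (adm_triv J (hstab y) unit).
apply: hiso_sym; pose k := hto_point (hcoset (hstab y) (hstab y)).
exists k.
have c0 : (hstab y : {set gT}) \in rcosets (hstab y) (hstab y).
  by apply/rcosetsP; exists 1; rewrite ?group1 ?mulg1 ?rcoset1.
exists (fun _ => @hsub_pt _ _ (hright _) _ (@hright_inv _ _ _) _ c0) => [[c cP]|[]] //; apply: val_inj => /=.
by case/rcosetsP: cP => b bH ->; rewrite rcoset_id.
Qed.

Lemma adm_map_id J X : adm_map J (hid X : gmap X X).
Proof. exact: adm_map_stab. Qed.

Lemma adm_map_fold J X : adm_map J (hfold X : gmap (hsum X X) X).
Proof.
apply: adm_map_stab => u; apply/val_inj/setP=> a; apply/hstabP/hstabP.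
  by case: u => x [aG e]; split=> //=; rewrite e.
by case: u => x [aG] /= [e]; split.
Qed.

Lemma adm_map_empty J X : adm_map J (hfrom_empty X : gmap _ X).
Proof. by case. Qed.

Lemma adm_map_comp J (X Y Z : gset) (g : gmap Y Z) (f : gmap X Y) :
  adm_map J g -> adm_map J f -> adm_map J (hcomp g f : gmap X Z).
Proof.
move=> Jg Jf x.
set H := hstab (g (f x)); set K := hstab (f x); set M := hstab x.
have sKH : K \subset H by exact: hstab_map.
have sMK : M \subset K by exact: hstab_map.
have JKM : J K (hcoset K M) := Jf x.
have JI := adm_ind sKH (Jg (f x)) JKM.
apply: adm_iso JI.
pose T := hcoset K M.
have c0 : (M : {set gT}) \in rcosets M K.
  by apply/rcosetsP; exists 1; rewrite ?group1 ?mulg1 ?rcoset1.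
pose t0 : T := @hsub_pt _ _ (hright K) _ (@hright_inv _ K M) _ c0.
have tE k : k \in K -> val (hact T t0 k) = M :* k.
  by move=> kK; rewrite val_hsub // mkhsetE.
have i0 : is_ind_class (ind_class t0 1 : hindset H T).
  by apply/existsP; exists t0; apply/existsP; exists 1; rewrite group1 eqxx.
pose o0 : hind H T := @hsub_pt _ _ (hindset H T) _ (@ind_inv _ H _ T) _ i0.
have oE a : a \in H -> val (hact (hind H T) o0 a) = ind_class t0 a.
  by move=> aH; rewrite val_hsub // mkhsetE //= ind_act_class mul1g.
have clM t k h : k \in K -> ind_class (hact T t k) h = ind_class t (k * h).
  move=> kK; apply/setP=> u; apply/imsetP/imsetP=> -[k' k'K ->].
    exists (k * k'); rewrite ?groupM // hactM //.
    by rewrite invMg -!mulgA mulKg.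
  exists (k^-1 * k'); rewrite ?groupM ?groupV //.
  by rewrite hactM ?groupV // hactK // invMg invgK mulgA.
have tr : forall y, exists2 a, a \in H & y = hact (hind H T) o0 a.
  case=> O iO; have := iO; case/existsP=> t /existsP[h /andP[hH /eqP eO]].
  case/rcosetsP: (valP t) => k kK ek.
  have et : t = hact T t0 k by apply: val_inj; rewrite tE.
  have khH : k * h \in H by rewrite groupM // (subsetP sKH).
  exists (k * h) => //; apply: val_inj; rewrite (oE _ khH).
  apply: etrans eO _; rewrite et; exact: clM.
have := coset_iso tr.
have -> : hstab o0 = M.
  apply/val_inj/setP=> a; apply/hstabP/idP => [[aH e]|aM].
    have : (t0, a) \in ind_class t0 a.
      by apply/imsetP; exists 1; rewrite ?group1 // hact1 invg1 mul1g.
    have -> : ind_class t0 a = ind_class t0 1 by apply: etrans (esym (oE _ aH)) _; rewrite e.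
    case/imsetP=> k kK [et ea].
    move: ea; rewrite mulg1 => ->; rewrite groupV.
    have := congr1 val et; rewrite tE // /= => ->.
    by rewrite rcoset_refl.
  have aK := subsetP sMK _ aM.
  have aH := subsetP sKH _ aK.
  split=> //; apply: val_inj; apply: etrans (oE _ aH) _.
  have -> : ind_class t0 a = ind_class (hact T t0 a) 1 by rewrite clM // mulg1.
  have -> // : hact T t0 a = t0.
  by apply: val_inj; rewrite tE //= rcoset_id.
exact: hiso_sym.
Qed.

Lemma adm_map_pull J (X Y Z : gset) (f : gmap X Z) (g : gmap Y Z) :
  adm_map J f -> adm_map J (hpull2 f g : gmap _ Y).
Proof.
move=> Jf w.
set y := hpull2 f g w; set x := hpull1 f g w.
have exy : f x = g y by exact/eqP/(valP w).
set K := hstab y; set H := hstab (f x).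
have sKH : K :^ 1 \subset H by rewrite conjsg1 /H exy; exact: hstab_map.
have JR : J K (hres sKH (hcoset H (hstab x))) := adm_res sKH (Jf x).
set R := hres _ _ in JR.
have c0 : (hstab x : {set gT}) \in rcosets (hstab x) H.
  by apply/rcosetsP; exists 1; rewrite ?group1 ?mulg1 ?rcoset1.
pose t0 : R := @hsub_pt _ _ (hright H) _ (@hright_inv _ H _) _ c0.
have JO : J K (horbit t0) := adm_sub _ JR.
apply: adm_iso JO.
have m0 : t0 \in orbit (hact R) K t0 by apply: orbit_refl.
pose o0 : horbit t0 := @hsub_pt _ _ R _ (@orbit_inv _ K R t0) _ m0.
have tr : forall u, exists2 a, a \in K & u = hact (horbit t0) o0 a.
  case=> u iu; have := iu; case/imsetP=> a aK eu; exists a => //.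
  by apply: val_inj; rewrite val_hsub //= eu.
have := coset_iso tr.
have -> : hstab o0 = hstab w.
  apply/val_inj/setP=> a.
  have wE : a \in [set: gT] -> hact (hpull f g) w a = w <->
      hact X x a = x /\ hact Y y a = y.
    move=> aG; split=> [e|[ex ey]].
      by split; rewrite /x /y -hmapP // e.
    by apply: val_inj; rewrite val_hsub // mkhsetE // ex ey -surjective_pairing.
  have oE : a \in K -> val (val (hact (horbit t0) o0 a)) = hstab x :* a.
    move=> aK; rewrite val_hsub // mkhsetE // val_hsub; last first.
      by apply: (subsetP sKH); rewrite conjsg1 conjg1.
    by rewrite mkhsetE /= ?conjg1 //; apply: (subsetP sKH); rewrite conjsg1.
  apply/hstabP/hstabP=> [[aK e]|[aG /wE e]].
    have aG : a \in [set: gT] by rewrite inE.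
    split=> //; apply/(wE aG); split; last by case/hstabP: aK.
    have : a \in hstab x by have := oE aK; rewrite e /= => ->; rewrite rcoset_refl.
    by case/hstabP.
  have [ex ey] := e aG.
  have aK : a \in K by apply/hstabP.
  have ax : a \in hstab x by apply/hstabP.
  split=> //; apply: val_inj; apply: val_inj; rewrite oE //=.
  by rewrite rcoset_id.
exact: hiso_sym.
Qed.

End IndexingSystems.

Arguments adm_map_pull {gT J X Y Z f} g _ _.
Arguments adm_map_comp {gT J X Y Z g f} _ _ _.
Arguments adm_map_id {gT} J X y.
Arguments adm_map_fold {gT} J X y.
Arguments adm_map_empty {gT} J X y.

Section Bispans.
Variable gT : finGroupType.
Notation gset := (gset gT).
Notation gpt := (hpoint [set: gT]%G : gset).
Notation g0 := (hempty [set: gT]%G : gset).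
Implicit Types (X Y Z W V : gset) (J : indexing_system gT).

(* Bispans X <- bdom -> bcod -> W with admissible middle map. *)

Record bispan J X W := Bispan {
  bdom : gset;
  bcod : gset;
  bres : gmap bdom X;
  bnorm : gmap bdom bcod;
  btr : gmap bcod W;
  badm : adm_map J bnorm }.

Arguments badm {J X W} b y.

Definition bispan_iso J X W (b c : bispan J X W) : Prop :=
  exists (f : gmap (bdom b) (bdom c)) (g : gmap (bcod b) (bcod c)),
    [/\ bijective f, bijective g, bres c \o f =1 bres b,
        bnorm c \o f =1 g \o bnorm b & btr c \o g =1 btr b].

Definition bid J X : bispan J X X :=
  Bispan (hid X) (hid X) (adm_map_id J X).

(* The composite c o b: with Q the pullback of the transfer of b and the      *)
(* restriction of c, form the exponential diagram of Q -> bdom c -> bcod c,   *)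
(* that is, the dependent product E with the evaluation F -> Q out of its     *)
(* pullback F to bdom c, and pull the norm of b back along F -> Q -> bcod b.  *)

Section Comp.
Variables (J : indexing_system gT) (X W V : gset).
Variables (b : bispan J X W) (c : bispan J W V).

Let q : gmap (hpull (btr b) (bres c)) (bdom c) := hpull2 (btr b) (bres c).
Let E := hdproj (bnorm c) q.
Let e : gmap (hpull (bnorm c) E) (bcod b) :=
  hcomp (hpull1 (btr b) (bres c)) (hev (bnorm c) q).

Definition bcomp : bispan J X V :=
  Bispan (hcomp (bres b) (hpull1 (bnorm b) e)) (hcomp (btr c) E)
    (adm_map_comp (adm_map_pull E (badm c)) (adm_map_pull e (badm b))).
End Comp.

Definition bsub J J' (sJ : forall H (T : hset H), J H T -> J' H T) X W
    (b : bispan J X W) : bispan J' X W :=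
  Bispan (bres b) (btr b) (fun y => sJ _ _ (badm b y)).

Definition bR J X Y (f : gmap Y X) : bispan J X Y :=
  Bispan f (hid Y) (adm_map_id J Y).
Definition bN J Y Z (g : gmap Y Z) (Jg : adm_map J g) : bispan J Y Z :=
  Bispan (hid Y) (hid Z) Jg.
Definition bT J Z W (h : gmap Z W) : bispan J Z W :=
  Bispan (hid Z) h (adm_map_id J Z).

(* J-Tambara functors with values T X. The product of X and Y for bispans is  *)
(* their disjoint union, with projections the restrictions along inclusions;  *)
(* the inverses (point and pairing) of the comparison maps expressing that    *)
(* products are preserved are part of the data, being uniquely determined.    *)

Record functor_on J (T : gset -> Type) := FunctorOn {
  fact : forall X W, bispan J X W -> T X -> T W;
  fact_iso : forall X W (b c : bispan J X W), bispan_iso b c ->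
    forall x, fact b x = fact c x;
  fact_id : forall X x, fact (bid J X) x = x;
  fact_comp : forall X W V (b : bispan J X W) (c : bispan J W V) x,
    fact (bcomp b c) x = fact c (fact b x) }.

Record product_functor_on J (T : gset -> Type) := ProductFunctorOn {
  pfunctor :> functor_on J T;
  tpoint : T g0;
  tpointE : forall t : T g0, t = tpoint;
  tpair : forall X Y, T X -> T Y -> T (hsum X Y);
  tpair1 : forall X Y (x : T X) (y : T Y),
    fact pfunctor (bR J (hinl X Y)) (tpair x y) = x;
  tpair2 : forall X Y (x : T X) (y : T Y),
    fact pfunctor (bR J (hinr X Y)) (tpair x y) = y;
  tpairK : forall X Y (z : T (hsum X Y)),
    tpair (fact pfunctor (bR J (hinl X Y)) z)
          (fact pfunctor (bR J (hinr X Y)) z) = z }.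

Section Operations.
Variables (J : indexing_system gT) (T : gset -> Type).
Variables (F : product_functor_on J T).

Definition tres X Y (f : gmap Y X) : T X -> T Y := fact F (bR J f).
Definition ttr Z W (h : gmap Z W) : T Z -> T W := fact F (bT J h).
Definition tnorm Y Z (g : gmap Y Z) (Jg : adm_map J g) : T Y -> T Z :=
  fact F (bN Jg).

Variable X : gset.
Definition tadd (x y : T X) : T X := ttr (hfold X) (tpair F x y).
Definition tzero : T X := ttr (hfrom_empty X) (tpoint F).
Definition tmul (x y : T X) : T X :=
  tnorm (adm_map_fold J X) (tpair F x y).
Definition tone : T X := tnorm (adm_map_empty J X) (tpoint F).
Definition texp (x : T X) (n : nat) : T X := iter n (tmul x) tone.
End Operations.

Record tambara_on J (T : gset -> Type) := TambaraOn {
  tfunctor :> product_functor_on J T;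
  topp : forall X, T X -> T X;
  taddA : forall X, associative (@tadd J T tfunctor X);
  taddC : forall X, commutative (@tadd J T tfunctor X);
  tadd0 : forall X, left_id (tzero tfunctor X) (@tadd J T tfunctor X);
  taddN : forall X,
    left_inverse (tzero tfunctor X) (@topp X) (@tadd J T tfunctor X) }.

Record tambara J := Tambara {
  tval :> gset -> Type;
  tstr :> tambara_on J tval }.

Record tmor J (S T : tambara J) := TMor {
  tmfun :> forall X, S X -> T X;
  tmorP : forall X W (b : bispan J X W) x,
    tmfun (fact S b x) = fact T b (tmfun x) }.

Definition tmor_iso J (S T : tambara J) (f : tmor S T) : Prop :=
  exists g : tmor T S, forall X, cancel (f X) (g X) /\ cancel (g X) (f X).

Section Forget.
Variables (J J' : indexing_system gT).
Hypothesis sJ : forall H (T : hset H), J H T -> J' H T.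

Lemma same_bispan_iso X W (Y Z : gset) (f : gmap Y X) (g : gmap Y Z)
    (h : gmap Z W) (Jg Jg' : adm_map J' g) :
  bispan_iso (Bispan f h Jg) (Bispan f h Jg').
Proof. by exists (hid Y), (hid Z); split=> //=; exists id. Qed.

Section ForgetOn.
Variables (T : gset -> Type) (F : tambara_on J' T).

Let fa X W (b : bispan J X W) : T X -> T W := fact F (bsub sJ b).

Fact forget_iso X W (b c : bispan J X W) :
  bispan_iso b c -> forall x, fa b x = fa c x.
Proof. by case=> f [g e] x; apply: fact_iso; exists f, g. Qed.

Fact forget_id X x : fa (bid J X) x = x.
Proof.
rewrite -[RHS](fact_id F); apply: fact_iso; exact: same_bispan_iso.
Qed.

Fact forget_comp X W V (b : bispan J X W) (c : bispan J W V) x :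
  fa (bcomp b c) x = fa c (fa b x).
Proof.
rewrite /fa -fact_comp; apply: fact_iso; exact: same_bispan_iso.
Qed.

Definition forget_functor : functor_on J T :=
  FunctorOn forget_iso forget_id forget_comp.

Fact forget_R X Y (f : gmap Y X) x : fact F (bR J' f) x = fa (bR J f) x.
Proof. apply: fact_iso; exact: same_bispan_iso. Qed.

Fact forget_T X Y (f : gmap X Y) x : fact F (bT J' f) x = fa (bT J f) x.
Proof. apply: fact_iso; exact: same_bispan_iso. Qed.

Fact forget_pair1 X Y (x : T X) (y : T Y) :
  fact forget_functor (bR J (hinl X Y)) (tpair F x y) = x.
Proof. by rewrite -[LHS]forget_R tpair1. Qed.

Fact forget_pair2 X Y (x : T X) (y : T Y) :
  fact forget_functor (bR J (hinr X Y)) (tpair F x y) = y.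
Proof. by rewrite -[LHS]forget_R tpair2. Qed.

Fact forget_pairK X Y (z : T (hsum X Y)) :
  tpair F (fact forget_functor (bR J (hinl X Y)) z)
          (fact forget_functor (bR J (hinr X Y)) z) = z.
Proof.
by rewrite -[fact _ _ _ in X in tpair F X _]forget_R
           -[fact _ (bR J (hinr X Y)) _]forget_R tpairK.
Qed.

Definition forget_product : product_functor_on J T :=
  ProductFunctorOn (tpointE F) forget_pair1 forget_pair2 forget_pairK.

Fact forget_add X (x y : T X) : tadd forget_product x y = tadd F x y.
Proof. by rewrite /tadd /ttr forget_T. Qed.

Fact forget_zero X : tzero forget_product X = tzero F X.
Proof. by rewrite /tzero /ttr forget_T. Qed.

Fact forget_addA X : associative (@tadd J T forget_product X).
Proof. by move=> x y z; rewrite !forget_add taddA. Qed.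
Fact forget_addC X : commutative (@tadd J T forget_product X).
Proof. by move=> x y; rewrite !forget_add taddC. Qed.
Fact forget_add0 X :
  left_id (tzero forget_product X) (@tadd J T forget_product X).
Proof. by move=> x; rewrite forget_zero forget_add tadd0. Qed.
Fact forget_addN X : left_inverse (tzero forget_product X) (@topp J' T F X)
  (@tadd J T forget_product X).
Proof. by move=> x; rewrite forget_zero forget_add taddN. Qed.

Definition tforget_on : tambara_on J T :=
  TambaraOn forget_addA forget_addC forget_add0 forget_addN.
End ForgetOn.

Definition tforget (T : tambara J') : tambara J := Tambara (tforget_on T).
End Forget.

Section Product.
Variables (J : indexing_system gT) (I : Type) (F : I -> tambara J).

Let T X := forall i, F i X.
Let fa X W (b : bispan J X W) (x : T X) : T W := fun i => fact (F i) b (x i).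

Fact tprod_iso X W (b c : bispan J X W) :
  bispan_iso b c -> forall x, fa b x = fa c x.
Proof.
by move=> e x; apply: functional_extensionality_dep => i; apply: fact_iso.
Qed.

Fact tprod_id X x : fa (bid J X) x = x.
Proof. by apply: functional_extensionality_dep => i; apply: fact_id. Qed.

Fact tprod_comp X W V (b : bispan J X W) (c : bispan J W V) x :
  fa (bcomp b c) x = fa c (fa b x).
Proof. by apply: functional_extensionality_dep => i; apply: fact_comp. Qed.

Definition tprod_functor : functor_on J T :=
  FunctorOn tprod_iso tprod_id tprod_comp.

Fact tprod_pointE (t : T g0) : t = fun i => tpoint (F i).
Proof. by apply: functional_extensionality_dep => i; apply: tpointE. Qed.

Let pair X Y (x : T X) (y : T Y) : T (hsum X Y) :=
  fun i => tpair (F i) (x i) (y i).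

Fact tprod_pair1 X Y (x : T X) (y : T Y) :
  fact tprod_functor (bR J (hinl X Y)) (pair x y) = x.
Proof. by apply: functional_extensionality_dep => i; apply: tpair1. Qed.

Fact tprod_pair2 X Y (x : T X) (y : T Y) :
  fact tprod_functor (bR J (hinr X Y)) (pair x y) = y.
Proof. by apply: functional_extensionality_dep => i; apply: tpair2. Qed.

Fact tprod_pairK X Y (z : T (hsum X Y)) :
  pair (fact tprod_functor (bR J (hinl X Y)) z)
       (fact tprod_functor (bR J (hinr X Y)) z) = z.
Proof. by apply: functional_extensionality_dep => i; apply: tpairK. Qed.

Definition tprod_product : product_functor_on J T :=
  ProductFunctorOn tprod_pointE tprod_pair1 tprod_pair2 tprod_pairK.

Fact tprod_addA X : associative (@tadd J T tprod_product X).
Proof. by move=> x y z; apply: functional_extensionality_dep => i; apply: taddA. Qed.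
Fact tprod_addC X : commutative (@tadd J T tprod_product X).
Proof. by move=> x y; apply: functional_extensionality_dep => i; apply: taddC. Qed.
Fact tprod_add0 X :
  left_id (tzero tprod_product X) (@tadd J T tprod_product X).
Proof. by move=> x; apply: functional_extensionality_dep => i; apply: tadd0. Qed.
Fact tprod_addN X : left_inverse (tzero tprod_product X)
  (fun x : T X => fun i => topp (F i) (x i)) (@tadd J T tprod_product X).
Proof. by move=> x; apply: functional_extensionality_dep => i; apply: taddN. Qed.

Definition tprod : tambara J :=
  Tambara (TambaraOn tprod_addA tprod_addC tprod_add0 tprod_addN).

Variables (S : tambara J) (f : forall i, tmor S (F i)).

Fact tassembleP X W (b : bispan J X W) (x : S X) :
  (fun i => f i W (fact S b x)) = fact tprod b (fun i => f i X x).
Proof. by apply: functional_extensionality_dep => i; apply: tmorP. Qed.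

Definition tassemble : tmor S tprod :=
  @TMor J S tprod (fun X x i => f i X x) tassembleP.
End Product.

Definition tmor_forget J J' (sJ : forall H (T : hset H), J H T -> J' H T)
    (S T : tambara J') (f : tmor S T) : tmor (tforget sJ S) (tforget sJ T) :=
  @TMor J (tforget sJ S) (tforget sJ T) (@tmfun J' S T f)
    (fun X W b => @tmorP J' S T f X W (bsub sJ b)).

End Bispans.

(* The P-local Burnside Tambara functor. A set of primes is a nat_pred, of    *)
(* which only the prime members matter; P^'.-nat n says that n > 0 is         *)
(* invertible in Z_(P).                                                       *)

Section Burnside.
Variable gT : finGroupType.
Notation gset := (gset gT).
Notation gpt := (hpoint [set: gT]%G : gset).
Notation g0 := (hempty [set: gT]%G : gset).
Implicit Types (X Y Z W : gset).

(* Finite G-sets over X; for X = G/H these are the finite H-sets, restriction,*)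
(* induction and coinduction along K <= H being pullback, composition and     *)
(* dependent product along G/K -> G/H.                                        *)

Record gover X := GOver { gtot :> gset; gproj : gmap gtot X }.

Definition over_iso X (S S' : gover X) : Prop :=
  exists f : gmap S S', bijective f /\ gproj S' \o f =1 gproj S.

Definition oempty X : gover X := GOver (hfrom_empty X).
Definition osum X (S S' : gover X) : gover X :=
  GOver (hcase (gproj S) (gproj S')).
Definition omul X n (S : gover X) : gover X := iter n (osum S) (oempty X).

Definition opull X Y (f : gmap Y X) (S : gover X) : gover Y :=
  GOver (hpull1 f (gproj S)).
Definition opush Z W (h : gmap Z W) (S : gover Z) : gover W :=
  GOver (hcomp h (gproj S)).
Definition odprod Y Z (g : gmap Y Z) (S : gover Y) : gover Z :=
  GOver (hdproj g (gproj S)).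

(* burnside P X is the localization at P of the Grothendieck group of finite  *)
(* G-sets over X: classes of formal fractions ([fpos] - [fneg]) / fden.       *)

Variable P : nat_pred.

Record frac X := Frac {
  fpos : gover X; fneg : gover X; fden : nat; fdenP : P^'.-nat fden }.

Definition frac_eq X (s t : frac X) : Prop :=
  exists n (C : gover X), P^'.-nat n /\
    over_iso
      (osum (omul n (osum (omul (fden t) (fpos s)) (omul (fden s) (fneg t)))) C)
      (osum (omul n (osum (omul (fden s) (fpos t)) (omul (fden t) (fneg s)))) C).

Definition burnside X : Type :=
  {c : frac X -> Prop | exists t : frac X, c = frac_eq t}.

Definition bfrac X (t : frac X) : burnside X :=
  exist _ (frac_eq t) (ex_intro _ t erefl).

Definition bset X (S : gover X) : burnside X :=
  bfrac (@Frac X S (oempty X) 1 isT).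

Fact frac_add_den X (s t : frac X) : P^'.-nat (fden s * fden t)%N.
Proof. by rewrite pnatM !fdenP. Qed.

Definition frac_add X (s t : frac X) : frac X :=
  Frac (osum (omul (fden t) (fpos s)) (omul (fden s) (fpos t)))
       (osum (omul (fden t) (fneg s)) (omul (fden s) (fneg t)))
       (frac_add_den s t).

Definition complete_system : indexing_system gT :=
  @IndexingSystem gT (fun _ _ => True) (fun _ _ _ _ _ => I)
    (fun _ _ _ _ _ _ => I) (fun _ _ => I) (fun _ _ _ _ _ => I)
    (fun _ _ _ _ _ _ _ _ _ => I) (fun _ _ _ _ _ _ => I).

(* The Tambara functor A(-)_(P). Its structure is determined by these         *)
(* requirements, as classes of G-sets generate and norms of differences and   *)
(* fractions are forced by the relations in the bispan category.              *)

Record burnside_tambara := BurnsideTambara {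
  btambara :> tambara_on complete_system burnside;
  bt_add : forall X (s t : frac X),
    tadd btambara (bfrac s) (bfrac t) = bfrac (frac_add s t);
  bt_res : forall X Y (f : gmap Y X) (S : gover X),
    tres btambara f (bset S) = bset (opull f S);
  bt_tr : forall Z W (h : gmap Z W) (S : gover Z),
    ttr btambara h (bset S) = bset (opush h S);
  bt_norm : forall Y Z (g : gmap Y Z) (Jg : adm_map complete_system g)
      (S : gover Y),
    tnorm btambara Jg (bset S) = bset (odprod g S) }.

(* A(G)_(P) is burnside gpt, G/G being a point. The marks take values in the  *)
(* subring Z_(P) of rat, as a multiple of any x by some fden is a difference  *)
(* of classes of G-sets.                                                      *)

Definition is_mark (A : burnside_tambara) (Q : {group gT})
    (phi : burnside gpt -> rat) : Prop :=
  [/\ phi (tone A gpt) = 1%R,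
      forall x y, phi (tadd A x y) = (phi x + phi y)%R,
      forall x y, phi (tmul A x y) = (phi x * phi y)%R &
      forall S : gover gpt, phi (bset S) = (#|'Fix_(hact (gtot S))(Q)|%:R)%R].

(* O^P(Q); solv_residualP shows that this intersection is the least member of *)
(* the family.                                                                *)

Definition solv_residual (Q : {group gT}) : {group gT} :=
  (\bigcap_(N : {group gT} | [&& N <| Q, solvable (Q / N) & P.-group (Q / N)])
     N)%G.

Lemma solv_residualP (Q : {group gT}) :
  [/\ solv_residual Q <| Q, solvable (Q / solv_residual Q),
      P.-group (Q / solv_residual Q) &
      forall M : {group gT}, M <| Q -> solvable (Q / M) -> P.-group (Q / M) ->
        solv_residual Q \subset M].
Proof.
have cap (A B : {group gT}) : A <| Q -> B <| Q ->
    solvable (Q / A) && P.-group (Q / A) ->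
    solvable (Q / B) && P.-group (Q / B) ->
    solvable (Q / (A :&: B)) && P.-group (Q / (A :&: B)).
  move=> nA nB /andP[sA pA] /andP[sB pB].
  have nK : A :&: B <| Q by exact: normalI.
  have nAK : A / (A :&: B) <| Q / (A :&: B) by exact: quotient_normal.
  have i3 := third_isog (subsetIl A B) nK nA.
  have nBA : A \subset 'N(B) := subset_trans (normal_sub nA) (normal_norm nB).
  have i2 := second_isog nBA; rewrite setIC in i2.
  have sAB := quotientS B (normal_sub nA).
  have pAK : P.-group (A / (A :&: B)) by rewrite (isog_pgroup _ i2) (pgroupS sAB).
  have sAK : solvable (A / (A :&: B)) by rewrite (isog_sol i2) (solvableS sAB).
  rewrite (series_sol nAK) sAK (isog_sol i3) sA /=.
  by rewrite -(pquotient_pgroup pAK) ?normal_norm // (isog_pgroup _ i3).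
have sM (M : {group gT}) : M <| Q -> solvable (Q / M) -> P.-group (Q / M) ->
    solv_residual Q \subset M.
  by move=> nM solM pM; apply: bigcap_inf; rewrite nM solM.
have [nQ solQ pQ] : [/\ Q <| Q, solvable (Q / Q) & P.-group (Q / Q)].
  by rewrite normal_refl trivg_quotient solvable1 pgroup1.
pose good (N : {group gT}) :=
  [&& Q :&: N <| Q, solvable (Q / (Q :&: N)) & P.-group (Q / (Q :&: N))].
suff /and3P[] : good (solv_residual Q).
  by rewrite (setIidPr (sM Q nQ solQ pQ)).
suff [M eM gM] : exists2 M : {group gT}, M :=: solv_residual Q & good M.
  by rewrite -(_ : M = solv_residual Q) //; apply: val_inj.
apply: (big_ind (fun S : {set gT} => exists2 M : {group gT}, M :=: S & good M)).
- by exists [set: gT]%G; rewrite // /good /= setIT nQ solQ.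
- move=> _ _ [M <- /and3P[nM sM' pM]] [N <- /and3P[nN sN pN]].
  exists (M :&: N)%G; rewrite // /good /=.
  have -> : Q :&: (M :&: N) = (Q :&: M) :&: (Q :&: N) by rewrite setIACA setIid.
  by rewrite normalI //=; apply: cap; rewrite // ?sM' ?sN.
move=> N /and3P[nN solN pN]; exists N => //.
by rewrite /good (setIidPr (normal_sub nN)) nN solN.
Qed.

Definition is_perfect (Q : {group gT}) : bool := solv_residual Q == Q.

Definition perfect_class : Type :=
  {C : {set {group gT}} |
    [exists L : {group gT}, is_perfect L && (C == orbit 'JG [set: gT] L)]}.

Implicit Type C : perfect_class.

Definition is_dress_idempotent (A : burnside_tambara) C (e : burnside gpt) :=
  forall Q phi, is_mark A Q phi -> phi e = ((solv_residual Q \in val C)%:R)%R.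

Lemma perfect_class_conj C (L : {group gT}) x :
  L \in val C -> (L :^ x)%G \in val C.
Proof.
case: C => C /= /existsP[L0 /andP[_ /eqP ->]] /imsetP[y _ ->].
by apply/imsetP; exists (y * x); rewrite ?inE // actM.
Qed.

(* Membership in I_L(H), L being any representative of C. *)

Definition class_adm C (H : {group gT}) (T : hset H) : Prop :=
  forall t : T, exists K : {group gT},
    [/\ K \subset H, hisomorphic (horbit t) (hcoset H K) &
        forall L, L \in val C -> L \subset H -> L \subset K].

Lemma class_admP C (H : {group gT}) (T : hset H) : class_adm C T <->
  forall L, L \in val C -> L \subset H ->
    {in L, forall a, forall t : T, hact T t a = t}.
Proof.
split=> [adT L CL sLH a aL t|fixT t].
  have [K [sKH [f [g fK gK]] sCK]] := adT t.
  have aH := subsetP sLH _ aL.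
  pose o : horbit t := @hsub_pt _ _ T _ (@orbit_inv _ H T t) t (orbit_refl _ _ t).
  suff : hact (horbit t) o a = o.
    by move/(congr1 val); rewrite val_hsub.
  apply: (can_inj fK); apply: val_inj; rewrite hmapP // val_hsub // mkhsetE //.
  case/rcosetsP: (valP (f o)) => b bH ->.
  have bL : a ^ b^-1 \in (L :^ b^-1)%G by rewrite memJ_conjg.
  have sLK : (L :^ b^-1)%G \subset K.
    apply: sCK; first exact: perfect_class_conj.
    by rewrite /= -(conjGid (groupVr bH)) conjSg.
  rewrite -rcosetM; have -> : b * a = a ^ b^-1 * b.
    by rewrite conjgE invgK !mulgA mulgKV.
  by rewrite rcosetM rcoset_id // (subsetP sLK).
pose o : horbit t := @hsub_pt _ _ T _ (@orbit_inv _ H T t) t (orbit_refl _ _ t).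
have tr : forall u, exists2 a, a \in H & u = hact (horbit t) o a.
  case=> u iu; have := iu; case/imsetP=> a aH eu; exists a => //.
  by apply: val_inj; rewrite val_hsub //= eu.
exists (hstab o); split; first exact: hstab_sub.
  exact/hiso_sym/coset_iso.
move=> L CL sLH; apply/subsetP=> a aL; have aH := subsetP sLH _ aL.
apply/hstabP; split=> //; apply: val_inj; rewrite val_hsub //=.
exact: (fixT L CL sLH a aL t).
Qed.

Fact class_adm_iso C H (X Y : hset H) :
  hisomorphic X Y -> class_adm C X -> class_adm C Y.
Proof.
case=> f [g fK gK] /class_admP aX; apply/class_admP=> L CL sLH a aL y.
by rewrite -(gK y) -hmapP ?(subsetP sLH) // (aX L).
Qed.

Fact class_adm_res C (H K : {group gT}) x (sKH : K :^ x \subset H)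
    (T : hset H) : class_adm C T -> class_adm C (hres sKH T).
Proof.
move/class_admP=> aT; apply/class_admP=> L CL sLK a aL t.
rewrite mkhsetE ?(subsetP sLK) //.
apply: (aT (L :^ x)%G); rewrite /= ?memJ_conjg ?perfect_class_conj //.
by apply: (subset_trans _ sKH); rewrite conjSg.
Qed.

Fact class_adm_triv C H (T : finType) : class_adm C (htriv H T).
Proof. by apply/class_admP. Qed.

Fact class_adm_sum C H (X Y : hset H) :
  class_adm C X -> class_adm C Y -> class_adm C (hsum X Y).
Proof.
move=> /class_admP aX /class_admP aY; apply/class_admP=> L CL sLH a aL.
by case=> u /=; rewrite ?(aX L) ?(aY L).
Qed.

Fact class_adm_pull C H (X Y Z : hset H) (f : hmap X Z) (g : hmap Y Z) :
  class_adm C X -> class_adm C Y -> class_adm C Z -> class_adm C (hpull f g).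
Proof.
move=> /class_admP aX /class_admP aY _; apply/class_admP=> L CL sLH a aL u.
have aH := subsetP sLH _ aL; apply: val_inj.
rewrite val_hsub // mkhsetE // (aX L) // (aY L) //.
by rewrite -surjective_pairing.
Qed.

Fact class_adm_ind C (H K : {group gT}) (T : hset K) : K \subset H ->
  class_adm C (hcoset H K) -> class_adm C T -> class_adm C (hind H T).
Proof.
move=> sKH /class_admP aHK /class_admP aT; apply/class_admP=> L CL sLH a aL u.
have aH := subsetP sLH _ aL; apply: val_inj; rewrite val_hsub // mkhsetE //.
case/existsP: (valP u) => t /existsP[h /andP[hH /eqP ->]].
rewrite ind_act_class.
have CLh : (L :^ h^-1)%G \in val C by exact: perfect_class_conj.
have sLhH : (L :^ h^-1)%G \subset H.
  by rewrite /= -(conjGid (groupVr hH)) conjSg.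
have sLhK : (L :^ h^-1)%G \subset K.
  apply/subsetP=> k kL.
  have K0 : (K : {set gT}) \in rcosets K H.
    by apply/rcosetsP; exists 1; rewrite ?group1 ?mulg1 ?rcoset1.
  pose o : hcoset H K := @hsub_pt _ _ (hright H) _ (@hright_inv _ H K) _ K0.
  have := congr1 val (aHK _ CLh sLhH k kL o).
  rewrite val_hsub ?(subsetP sLhH) // mkhsetE ?(subsetP sLhH) //= => <-.
  exact: rcoset_refl.
have [k ek] : {k | k = a ^ h^-1} by exists (a ^ h^-1).
have kL : k \in (L :^ h^-1)%G by rewrite ek memJ_conjg.
have kK : k \in K by exact: (subsetP sLhK).
have -> : h * a = k * h by rewrite ek conjgE invgK !mulgA mulgKV.
transitivity (ind_class (hact T t k) h); last by rewrite (aT _ CLh sLhK k kL).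
apply/setP=> v.
apply/imsetP/imsetP=> -[m mK ->].
  exists (k^-1 * m); rewrite ?groupM ?groupV //.
  by rewrite hactM ?groupV // hactK // invMg invgK mulgA.
exists (k * m); first exact: groupM.
by rewrite hactM // invMg -!mulgA mulKg.
Qed.

Definition class_system C : indexing_system gT :=
  IndexingSystem (@class_adm_iso C) (@class_adm_res C) (@class_adm_triv C)
    (@class_adm_sum C) (@class_adm_pull C) (@class_adm_ind C).

Definition total_adm (H : {group gT}) (T : hset H) : Prop :=
  forall C, class_system C H T.

Definition total_system : indexing_system gT.
Proof.
exists total_adm.
- by move=> H X Y e aX C; apply: adm_iso e (aX C).
- by move=> H K x sKH T aT C; apply: adm_res (aT C).
- by move=> H T C; apply: adm_triv.
- by move=> H X Y aX aY C; apply: adm_sum (aX C) (aY C).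
- by move=> H X Y Z f g aX aY aZ C; apply: adm_pull (aX C) (aY C) (aZ C).
- by move=> H K T sKH aK aT C; apply: adm_ind sKH (aK C) (aT C).
Defined.

Definition total_sub C (H : {group gT}) (T : hset H) :
  total_system H T -> class_system C H T := fun aT => aT C.

Definition complete_sub (J : indexing_system gT) (H : {group gT}) (T : hset H) :
  J H T -> complete_system H T := fun _ => I.

Definition forget_burnside (A : burnside_tambara) (J : indexing_system gT) :
    tambara J :=
  tforget (@complete_sub J) (Tambara A).

(* eta exhibits T' X as the localization of the commutative ring T X at the   *)
(* powers of s.                                                               *)

Definition is_localization (J J' : indexing_system gT) (T T' : gset -> Type)
    (A : tambara_on J T) (B : tambara_on J' T') X (s : T X)
    (eta : T X -> T' X) : Prop :=
  [/\ exists t, tmul B (eta s) t = tone B X,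
      forall b, exists a n, tmul B (texp B (eta s) n) b = eta a &
      forall a a', eta a = eta a' <->
        exists n, tmul A (texp A s n) a = tmul A (texp A s n) a'].

(* A(-)_(P)[e^-1] as an I_L-Tambara functor. As loc_map is a morphism of      *)
(* I_L-Tambara functors, the norms are those inherited from A(-)_(P).         *)

Record localization_tambara (A : burnside_tambara) C (e : burnside gpt) :=
  LocalizationTambara {
    loc_tambara :> tambara (class_system C);
    loc_map : tmor (forget_burnside A (class_system C)) loc_tambara;
    loc_mapP : forall H : {group gT},
      let GH : gset := hcoset [set: gT] H in
      is_localization A loc_tambara (tres A (hto_point GH) e)
        (@tmfun _ _ _ _ loc_map GH) }.

Fact loc_map_totalP (A : burnside_tambara) C e (B : localization_tambara A C e)
    X W (b : bispan total_system X W) x :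
  loc_map B W (fact (forget_burnside A total_system) b x) =
  fact (tforget (@total_sub C) B) b (loc_map B X x).
Proof. exact: (tmorP (loc_map B) (bsub (@total_sub C) b)). Qed.

Definition loc_map_total (A : burnside_tambara) C e
    (B : localization_tambara A C e) :
    tmor (forget_burnside A total_system) (tforget (@total_sub C) B) :=
  @TMor gT total_system (forget_burnside A total_system)
    (tforget (@total_sub C) B) (@tmfun _ _ _ _ (loc_map B)) (loc_map_totalP B).

Definition localization_product (A : burnside_tambara)
    (e : perfect_class -> burnside gpt)
    (B : forall C, localization_tambara A C (e C)) : tambara total_system :=
  tprod (fun C => tforget (@total_sub C) (B C)).

Definition localization_maps (A : burnside_tambara)
    (e : perfect_class -> burnside gpt)
    (B : forall C, localization_tambara A C (e C)) :
    tmor (forget_burnside A total_system) (localization_product B) :=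
  tassemble (fun C => loc_map_total (B C)).

End Burnside.

(* Main.v *)
Require Import Defs.
From HB Require Import structures.
From mathcomp Require Import all_boot all_order all_algebra all_fingroup all_solvable.
From mathcomp Require Import boolp ring lra.

Set Implicit Arguments.
Unset Strict Implicit.
Unset Printing Implicit Defensive.

(** Why the theorem holds.  An element of the P-local Burnside ring of G is
    determined by its marks: for classes of G-sets this is Burnside's theorem
    [nfix_hiso], and fractions reduce to it by clearing denominators
    ([mark_inj]).  The mark of the Dress idempotent of the class C at Q is 1
    when O^P(Q) lies in C and 0 otherwise.  As O^P(Q) is itself P-perfect
    ([solv_residual_idem]), it lies in exactly one class; comparing marks, the
    Dress idempotents are orthogonal idempotents with sum 1 ([dress_idem],
    [dress_orth], [dress_sum]).

    Restriction along G/H -> G/G is a ring homomorphism, so the restricted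
    idempotents decompose 1 in the ring at G/H as well.  Inverting an
    idempotent in a commutative ring projects onto the corresponding factor,
    so the ring at G/H is the product of the localizations
    ([localization_inj], [localization_surj]).  A Tambara functor turns
    disjoint unions into products and every G-set is a disjoint union of
    orbits, so the localization maps are jointly bijective on every G-set
    ([tmor_bij_orbits]); the inverse of a levelwise bijective natural
    transformation is natural ([tmor_bij_iso]).

    The ring structure has to be extracted from the category of bispans: sum
    and product are the transfer and the norm along fold maps, so the ring
    axioms and the compatibilities with restriction are identities between
    composites of bispans.  All of them are instances of one criterion,
    [bcomp_iso], which recognizes a bispan as the composite of two others. *)

Local Open Scope group_scope.

(** * Composites of bispans *)

Lemma inj_surj_bij (X Y : finType) (f : X -> Y) :
  injective f -> (forall y, exists x, f x = y) -> bijective f.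
Proof.
move=> f_inj f_surj.
have fP y : exists x, f x == y by have [x <-] := f_surj y; exists x.
exists (fun y => xchoose (fP y)) => [x|y]; last exact/eqP/(xchooseP (fP y)).
by apply: f_inj; exact/eqP/(xchooseP (fP (f x))).
Qed.

Lemma val_pull_act (gT : finGroupType) (H : {group gT}) (X Y Z : hset H)
    (f : hmap X Z) (g : hmap Y Z) (p : hpull f g) a : a \in H ->
  val (hact (hpull f g) p a) = (hact X (val p).1 a, hact Y (val p).2 a).
Proof. by move=> aH; rewrite val_hsub // mkhsetE. Qed.

(** The composite of b and c has as its codomain the pairs of a point z of
    [bcod c] and a section over the fibre of [bnorm c] at z, and as its domain
    the triples of such a pair, a point of that fibre and a point of [bdom b]
    over the value of the section.  A bispan d is this composite as soon as it
    comes with maps k, s (for the pairs) and l, m (for the triples) having the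
    corresponding universal property. *)
Section CompositeRecognition.
Variables (gT : finGroupType) (J : indexing_system gT) (X W V : gset gT).
Variables (b : bispan J X W) (c : bispan J W V) (d : bispan J X V).
Variables (k : gmap (bcod d) (bcod c)) (s : bcod d -> bdom c -> option (bcod b)).
Variables (l : gmap (bdom d) (bdom c)) (m : gmap (bdom d) (bdom b)).

(** Sections of b over the fibre at z, encoded as partial functions defined
    exactly on that fibre so as to match the encoding in [hsec]. *)
Definition fibre_section (z : bcod c) (t : bdom c -> option (bcod b)) :=
  forall y, if t y is Some v then btr b v = bres c y /\ bnorm c y = z
            else bnorm c y <> z.

Hypothesis btr_k : btr c \o k =1 btr d.
Hypothesis sP : forall e, fibre_section (k e) (s e).
Hypothesis s_act : forall a e y,
  s (hact (bcod d) e a) (hact (bdom c) y a) =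
  omap (fun v => hact (bcod b) v a) (s e y).
Hypothesis s_inj : forall e e', k e = k e' -> s e =1 s e' -> e = e'.
Hypothesis s_surj : forall z t, fibre_section z t ->
  exists2 e, k e = z & s e =1 t.
Hypothesis bres_m : bres b \o m =1 bres d.
Hypothesis s_lm : forall w, s (bnorm d w) (l w) = Some (bnorm b (m w)).
Hypothesis lm_inj : forall w w',
  bnorm d w = bnorm d w' -> l w = l w' -> m w = m w' -> w = w'.
Hypothesis lm_surj : forall e y u, s e y = Some (bnorm b u) ->
  exists w, [/\ bnorm d w = e, l w = y & m w = u].

Let PQ : gset gT := hpull (btr b) (bres c).
Let q : gmap PQ (bdom c) := hpull2 (btr b) (bres c).
Let D := hdprod (bnorm c) q.

Let sec e : {ffun bdom c -> option PQ} :=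
  [ffun y => obind (fun v => insub (v, y)) (s e y)].

Let sec_some e y v : s e y = Some v ->
  exists2 p : PQ, sec e y = Some p & val p = (v, y).
Proof.
move=> sE; have := sP e y; rewrite sE => -[tE _].
have pP : btr b (v, y).1 == bres c (v, y).2 by rewrite /= tE.
exists (exist _ (v, y) pP) => //; rewrite ffunE sE /=.
by rewrite insubT; congr Some; apply: val_inj.
Qed.

Let sec_none e y : s e y = None -> sec e y = None.
Proof. by rewrite ffunE => ->. Qed.

Let secP e : is_section (bnorm c) q (k e, sec e : hsec PQ (bdom c)).
Proof.
apply/forallP=> y; rewrite /=.
case sE: (s e y) => [v|]; last first.
  by rewrite sec_none //; have := sP e y; rewrite sE => /eqP.
have [p -> /= pE] := sec_some sE; rewrite /q /= pE eqxx /=.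
by have := sP e y; rewrite sE => -[_ ->].
Qed.

Let cod_fun (e : bcod d) : D := exist _ (k e, sec e) (secP e).

Let cod_act : {in [set: gT]%G, forall a, forall e,
  cod_fun (hact (bcod d) e a) = hact D (cod_fun e) a}.
Proof.
move=> a aG e; apply: val_inj; rewrite val_hsub // mkhsetE //=.
congr pair; first by rewrite hmapP.
rewrite /hextend aG; apply/ffunP=> y; rewrite /sec_act [RHS]ffunE.
have := s_act a e (hact (bdom c) y a^-1); rewrite hactKV //.
case sE: (s e _) => [v|] /= sE'; last by rewrite !sec_none.
have [p -> pE] := sec_some sE; have [p' -> pE'] := sec_some sE' => /=.
congr Some; apply: val_inj; rewrite pE'.
apply: (etrans _ (esym (val_pull_act p aG))).
by rewrite pE /= hactKV.
Qed.

Let cod_map : gmap (bcod d) D := HMap cod_act.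

Let cod_bij : bijective cod_map.
Proof.
apply: inj_surj_bij => [e e' /(congr1 val) [kE secE]|[[z t] tP]].
  apply: s_inj kE _ => y; have /ffunP/(_ y) := secE.
  case sE: (s e y) => [v|]; case sE': (s e' y) => [v'|] //.
  - have [p -> pE] := sec_some sE; have [p' -> pE'] := sec_some sE'.
    by case=> pp'; move: pE; rewrite pp' pE' => -[->].
  - by have [p -> pE] := sec_some sE; rewrite sec_none.
  by have [p' -> pE'] := sec_some sE'; rewrite sec_none.
pose t' y := omap (fun p : PQ => (val p).1) (t y).
have tsec : fibre_section z t'.
  move=> y; have /forallP/(_ y) /= := tP; rewrite /t'.
  case: (t y) => [p|] /=; last by move/eqP.
  case/andP=> /eqP <- /eqP <-; split=> //.
  by have /eqP := valP p.
have [e kE sE] := s_surj tsec; exists e; apply: val_inj => /=.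
congr pair => //; apply/ffunP=> y.
have /forallP/(_ y) /= := tP; have := sE y; rewrite /t'.
case: (t y) => [p|] /= spE; last by rewrite sec_none.
have [p' -> pE'] := sec_some spE => /andP[/eqP qE _]; congr Some.
by apply: val_inj; rewrite /= pE' -qE /q /=; case: (val p).
Qed.

Let E := hdproj (bnorm c) q.
Let PE : gset gT := hpull (bnorm c) E.

Let ev : gmap PE (bcod b) := hcomp (hpull1 (btr b) (bres c)) (hev (bnorm c) q).

Let pe_proof w : bnorm c (l w) == E (cod_map (bnorm d w)).
Proof. by have := sP (bnorm d w) (l w); rewrite s_lm => -[_ ->]. Qed.

Let pe w : PE := exist _ (l w, cod_map (bnorm d w)) (pe_proof w).

Let evE (x : PE) e v : (val x).2 = cod_map e -> s e (val x).1 = Some v ->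
  ev x = v.
Proof.
move=> xE sE; have [p secE pE] := sec_some sE.
have : Some (ev_fun x) = Some p by rewrite ev_funE xE /= secE.
by case; rewrite /ev /= => ->; rewrite pE.
Qed.

Let dom_proof w : bnorm b (m w) == ev (pe w).
Proof. by rewrite (@evE _ (bnorm d w) (bnorm b (m w))). Qed.

Let dom_fun (w : bdom d) : hpull (bnorm b) ev :=
  exist _ (m w, pe w) (dom_proof w).

Let pe_act w a : a \in [set: gT]%G ->
  pe (hact (bdom d) w a) = hact PE (pe w) a.
Proof.
move=> aG; apply: val_inj; rewrite [RHS]val_pull_act //.
rewrite [LHS]/=; congr pair; first by rewrite hmapP.
by rewrite [bnorm d _]hmapP //; exact: cod_act.
Qed.

Let dom_act : {in [set: gT]%G, forall a, forall w,
  dom_fun (hact (bdom d) w a) = hact (hpull (bnorm b) ev) (dom_fun w) a}.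
Proof.
move=> a aG w; apply: val_inj; rewrite [RHS]val_pull_act //.
by rewrite [LHS]/= pe_act // [m _]hmapP.
Qed.

Let dom_map : gmap (bdom d) (hpull (bnorm b) ev) := HMap dom_act.

Let dom_bij : bijective dom_map.
Proof.
apply: inj_surj_bij => [w w' /(congr1 val) [mE lE kE secE]|[[u [[y D0] yP]] uP]].
  apply: (lm_inj _ lE mE); apply: (bij_inj cod_bij); apply: val_inj.
  by rewrite /= kE secE.
have [cinv _ cK] := cod_bij.
have sE : s (cinv D0) y = Some (bnorm b u).
  have : bnorm c y == E D0 := yP.
  rewrite -[in E D0](cK D0) => /eqP yE.
  case sE: (s (cinv D0) y) => [v|]; last first.
    by have := sP (cinv D0) y; rewrite sE => /(_ yE).
  have /eqP := uP => /= ->; congr Some.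
  by symmetry; apply: (evE (e := cinv D0)); rewrite /= ?cK.
have [w [dE lE mE]] := lm_surj sE; exists w.
apply: val_inj => /=; congr pair => //; apply: val_inj => /=.
by congr pair => //; rewrite dE -[RHS]cK.
Qed.

Lemma bcomp_iso : bispan_iso d (bcomp b c).
Proof.
exists dom_map, cod_map; split; first exact: dom_bij.
- exact: cod_bij.
- exact: bres_m.
- by [].
exact: btr_k.
Qed.

End CompositeRecognition.

(** * Interchange rules *)

(** When the norm part of c is trivial, each fibre is a single point, and the
    composite is obtained from two pullbacks. *)
Section TrivialNorm.
Variables (gT : finGroupType) (J : indexing_system gT) (X W V Y : gset gT).
Variables (b : bispan J X W) (f : gmap Y W) (h : gmap Y V).
Variables (Jid : adm_map J (hid Y : gmap Y Y)) (d : bispan J X V).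
Variables (k : gmap (bcod d) Y) (v : gmap (bcod d) (bcod b)).
Variable m : gmap (bdom d) (bdom b).
Hypothesis hk : h \o k =1 btr d.
Hypothesis cod_comm : forall e, btr b (v e) = f (k e).
Hypothesis cod_inj : forall e e', k e = k e' -> v e = v e' -> e = e'.
Hypothesis cod_surj : forall y u, btr b u = f y -> exists e, k e = y /\ v e = u.
Hypothesis bres_m : bres b \o m =1 bres d.
Hypothesis dom_comm : forall w, bnorm b (m w) = v (bnorm d w).
Hypothesis dom_inj : forall w w', bnorm d w = bnorm d w' -> m w = m w' -> w = w'.
Hypothesis dom_surj : forall e u, bnorm b u = v e ->
  exists w, bnorm d w = e /\ m w = u.

Lemma bcomp_trivial_norm : bispan_iso d (bcomp b (Bispan f h Jid)).
Proof.
pose s e y := if y == k e then Some (v e) else None.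
apply: (@bcomp_iso _ _ _ _ _ b (Bispan f h Jid) d k s (hcomp k (bnorm d)) m) => //=.
- move=> e y; rewrite /s; case: eqP => [->|ne] /=; last by [].
  by split; [exact: cod_comm|].
- move=> a e y; rewrite /s !hmapP ?inE // (inj_eq (act_inj _ _)).
  by case: eqP.
- move=> e e' kE /(_ (k e)); rewrite /s -kE eqxx => -[vE].
  exact: cod_inj.
- move=> y t tP; have := tP y; case tyE: (t y) => [u|] //= [uE _].
  have [e [kE vE]] := cod_surj uE; exists e => // y'; rewrite /s kE.
  have := tP y'; case ty'E: (t y') => [u'|] /= => [[_ y'E]|ne].
    by rewrite y'E eqxx vE -tyE -ty'E y'E.
  by case: eqP.
- by move=> w; rewrite /s /= eqxx dom_comm.
- by move=> w w' dE _; exact: dom_inj.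
move=> e y u; rewrite /s; case: eqP => // -> [/esym uE].
by have [w [dE mE]] := dom_surj uE; exists w; rewrite /= dE.
Qed.
End TrivialNorm.

(** When the transfer part of b is trivial, a section over a fibre is forced,
    so that norms compose. *)
Section NormAfterNorm.
Variables (gT : finGroupType) (J : indexing_system gT) (X D W V : gset gT).
Variables (r : gmap D X) (f : gmap D W) (g : gmap W V).
Variables (gf : gmap D V) (gfE : gf =1 g \o f).
Variables (Jf : adm_map J f) (Jg : adm_map J g) (Jgf : adm_map J gf).

Lemma bcomp_norm :
  bispan_iso (Bispan r (hid V) Jgf) (bcomp (Bispan r (hid W) Jf) (bN Jg)).
Proof.
set b := Bispan r (hid W) Jf; set c := bN Jg; set d := Bispan r (hid V) Jgf.
(* The only section over the fibre of g at e is the inclusion of that fibre. *)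
pose s (e : V) (y : W) := if g y == e then Some y else None.
apply: (@bcomp_iso _ _ _ _ _ b c d (hid V) s f (hid D)) => //=.
- by move=> e y; rewrite /s; case: eqP.
- by move=> a e y; rewrite /s !hmapP ?inE // (inj_eq (act_inj _ _)); case: eqP.
- move=> z t tP; exists z => // y; have := tP y; rewrite /s /=.
  by case: (t y) => [u|] /= => [[-> /eqP->]|/eqP/negPf->].
- by move=> w; rewrite /s gfE eqxx.
by move=> e y u; rewrite /s; case: eqP => // <- [->]; exists u; rewrite gfE.
Qed.
End NormAfterNorm.

Definition cartesian (gT : finGroupType) (D Y V Z : gset gT)
    (p : gmap D Y) (q : gmap D V) (g : gmap Y Z) (h : gmap V Z) :=
  [/\ forall d, g (p d) = h (q d),
      forall d d', p d = p d' -> q d = q d' -> d = d' &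
      forall y v, g y = h v -> exists d, p d = y /\ q d = v].

Section Calculus.
Variables (gT : finGroupType) (J : indexing_system gT) (T : gset gT -> Type).
Variable F : product_functor_on J T.
Implicit Types X Y Z W V D : gset gT.

Lemma fact_comp_iso X W V (b : bispan J X W) (c : bispan J W V)
    (d : bispan J X V) x :
  bispan_iso d (bcomp b c) -> fact F c (fact F b x) = fact F d x.
Proof. by move=> /fact_iso->; rewrite fact_comp. Qed.

Lemma tres_eq X Y (f g : gmap Y X) x : f =1 g -> tres F f x = tres F g x.
Proof.
by move=> fg; apply: fact_iso; exists (hid _), (hid _); split=> //=; exists id.
Qed.

Lemma tresM X Y Z (f : gmap Y X) (g : gmap Z Y) x :
  tres F g (tres F f x) = tres F (hcomp f g) x.
Proof.
apply: fact_comp_iso.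
apply: (@bcomp_trivial_norm _ _ _ _ _ _ (bR J f) g (hid Z) _ (bR J (hcomp f g))
         (hid Z) g g) => //= [y u ->|e u ->]; by eexists.
Qed.

Lemma tres_id X (f : gmap X X) x : f =1 id -> tres F f x = x.
Proof.
move=> fid; rewrite -[RHS](fact_id F); apply: fact_iso.
by exists (hid _), (hid _); split=> //=; exists id.
Qed.

Lemma ttr_id X (f : gmap X X) x : f =1 id -> ttr F f x = x.
Proof.
move=> fid; rewrite -[RHS](fact_id F); apply: fact_iso.
by exists (hid _), (hid _); split=> //=; exists id.
Qed.

Lemma fact_resnorm X Y Z (r : gmap Y X) (g : gmap Y Z) (Jg : adm_map J g) x :
  fact F (Bispan r (hid Z) Jg) x = tnorm F Jg (tres F r x).
Proof. by symmetry; apply: fact_comp_iso; exact: bcomp_norm. Qed.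

Lemma tnorm_id X (f : gmap X X) (Jf : adm_map J f) x :
  f =1 id -> tnorm F Jf x = x.
Proof.
move=> fid; rewrite -[RHS](fact_id F); apply: fact_iso.
exists (hid _), (hid _).
by split=> // [||y]; [exists id | exists id | rewrite /= fid].
Qed.

Lemma tnormM X Y Z (f : gmap X Y) (g : gmap Y Z) (gf : gmap X Z)
    (Jf : adm_map J f) (Jg : adm_map J g) (Jgf : adm_map J gf) x :
  gf =1 g \o f -> tnorm F Jg (tnorm F Jf x) = tnorm F Jgf x.
Proof. by move=> gfE; apply: fact_comp_iso; exact: bcomp_norm. Qed.

(** Norms do not see how the points of the fibres are named; commutativity,
    associativity and unitality of products come from this. *)
Lemma tnorm_res_bij X Y Z (i : gmap Y X) (f : gmap Y Z) (g : gmap X Z)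
    (Jf : adm_map J f) (Jg : adm_map J g) x :
  bijective i -> f =1 g \o i -> tnorm F Jf (tres F i x) = tnorm F Jg x.
Proof.
move=> i_bij fE; rewrite -fact_resnorm; apply: fact_iso.
exists i, (hid _).
by split=> // [|y]; [exists id | rewrite /= fE].
Qed.

Lemma tres_norm D Y V Z (p : gmap D Y) (q : gmap D V) (g : gmap Y Z)
    (h : gmap V Z) (Jq : adm_map J q) (Jg : adm_map J g) x :
  cartesian p q g h -> tres F h (tnorm F Jg x) = tnorm F Jq (tres F p x).
Proof.
case=> comm inj surj; rewrite -fact_resnorm; apply: fact_comp_iso.
apply: (@bcomp_trivial_norm _ _ _ _ _ _ (bN Jg) h (hid V) _
          (Bispan p (hid V) Jq) (hid V) h p) => //=.
- by move=> y u ->; exists y.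
- by move=> w w' qE pE; apply: inj.
by move=> e u /surj[w [<- <-]]; exists w.
Qed.

Lemma tres_tr D Y V Z (p : gmap D Y) (q : gmap D V) (g : gmap Y Z)
    (h : gmap V Z) x :
  cartesian p q g h -> tres F h (ttr F g x) = ttr F q (tres F p x).
Proof.
case=> comm inj surj.
pose d : bispan J Y V := Bispan p q (adm_map_id J D).
transitivity (fact F d x).
  apply: fact_comp_iso.
  apply: (@bcomp_trivial_norm _ _ _ _ _ _ (bT J g) h (hid V) _ d q p p) => //=.
  - by move=> w w' qE pE; apply: inj.
  - by move=> y u /surj[w [<- <-]]; exists w.
  by move=> e u ->; exists e.
apply/esym/fact_comp_iso.
apply: (@bcomp_trivial_norm _ _ _ _ _ _ (bR J p) (hid D) q _ d
         (hid D) (hid D) (hid D)) => //= [y u ->|e u ->]; by eexists.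
Qed.

(** ** Disjoint unions *)

(** Preservation of products, in the form in which it is used: an element over
    a disjoint union is known from its two restrictions. *)
Lemma tpair_ext X Y (z z' : T (hsum X Y)) :
    tres F (hinl X Y) z = tres F (hinl X Y) z' ->
    tres F (hinr X Y) z = tres F (hinr X Y) z' -> z = z'.
Proof.
by move=> zl zr; rewrite -[z](tpairK F) -[z'](tpairK F); congr tpair.
Qed.

Lemma tres_pairl X Y x y : tres F (hinl X Y) (tpair F x y) = x.
Proof. exact: tpair1. Qed.

Lemma tres_pairr X Y x y : tres F (hinr X Y) (tpair F x y) = y.
Proof. exact: tpair2. Qed.

Definition hsummap X Y X' Y' (f : gmap X X') (g : gmap Y Y') :
    gmap (hsum X Y) (hsum X' Y') :=
  hcase (hcomp (hinl X' Y') f) (hcomp (hinr X' Y') g).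

Lemma adm_summap X Y X' Y' (f : gmap X X') (g : gmap Y Y') :
  adm_map J f -> adm_map J g -> adm_map J (hsummap f g).
Proof.
have stabl A B a : hstab (inl a : hsum A B : gset gT) = hstab a.
  apply/val_inj/setP=> x; apply/hstabP/hstabP=> -[xG] /=.
    by case.
  by move->.
have stabr A B a : hstab (inr a : hsum A B : gset gT) = hstab a.
  apply/val_inj/setP=> x; apply/hstabP/hstabP=> -[xG] /=.
    by case.
  by move->.
move=> Jf Jg [x|y] /=; first by rewrite !stabl; exact: Jf.
by rewrite !stabr; exact: Jg.
Qed.

Lemma cartesian_suml X Y X' Y' (f : gmap X X') (g : gmap Y Y') :
  cartesian (hinl X Y) f (hsummap f g) (hinl X' Y').
Proof.
split=> //= [x x' []//|[x|y] v [] //]; by move=> <-; exists x.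
Qed.

Lemma cartesian_sumr X Y X' Y' (f : gmap X X') (g : gmap Y Y') :
  cartesian (hinr X Y) g (hsummap f g) (hinr X' Y').
Proof.
split=> //= [x x' []//|[x|y] v [] //]; by move=> <-; exists y.
Qed.

Lemma tpair_res X Y X' Y' (f : gmap X X') (g : gmap Y Y') x y :
  tres F (hsummap f g) (tpair F x y) = tpair F (tres F f x) (tres F g y).
Proof.
apply: tpair_ext; rewrite tresM.
  by rewrite tres_pairl -[x in RHS](tres_pairl x y) tresM; apply: tres_eq.
by rewrite tres_pairr -[y in RHS](tres_pairr x y) tresM; apply: tres_eq.
Qed.

Lemma tpair_norm X Y X' Y' (f : gmap X X') (g : gmap Y Y')
    (Jf : adm_map J f) (Jg : adm_map J g) x y :
  tpair F (tnorm F Jf x) (tnorm F Jg y) =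
  tnorm F (adm_summap Jf Jg) (tpair F x y).
Proof.
apply: tpair_ext.
  rewrite tres_pairl (tres_norm _ _ _ (cartesian_suml f g)).
  by congr tnorm; rewrite tres_pairl.
rewrite tres_pairr (tres_norm _ _ _ (cartesian_sumr f g)).
by congr tnorm; rewrite tres_pairr.
Qed.

Lemma tpair_tr X Y X' Y' (f : gmap X X') (g : gmap Y Y') x y :
  tpair F (ttr F f x) (ttr F g y) = ttr F (hsummap f g) (tpair F x y).
Proof.
apply: tpair_ext.
  rewrite tres_pairl (tres_tr _ (cartesian_suml f g)).
  by congr ttr; rewrite tres_pairl.
rewrite tres_pairr (tres_tr _ (cartesian_sumr f g)).
by congr ttr; rewrite tres_pairr.
Qed.

End Calculus.

(** * The commutative rings of a Tambara functor *)

Section Multiplication.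
Variables (gT : finGroupType) (J : indexing_system gT) (T : gset gT -> Type).
Variable F : product_functor_on J T.
Implicit Types X Y Z W V D : gset gT.

Definition hswap X : gmap (hsum X X) (hsum X X) := hcase (hinr X X) (hinl X X).

Definition hassoc X : gmap (hsum X (hsum X X)) (hsum (hsum X X) X) :=
  hcase (hcomp (hinl _ _) (hinl X X)) (hsummap (hinr X X) (hid X)).

Lemma hswap_bij X : bijective (hswap X).
Proof. by exists (hswap X); case. Qed.

Lemma hassoc_bij X : bijective (hassoc X).
Proof.
pose g (u : hsum (hsum X X) X) : hsum X (hsum X X) :=
  match u with
  | inl (inl x) => inl x | inl (inr y) => inr (inl y) | inr z => inr (inr z)
  end.
by exists g; [case=> [x|[y|z]] | case=> [[x|y]|z]].
Qed.

Lemma tpair_swap X (x y : T X) :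
  tpair F y x = tres F (hswap X) (tpair F x y).
Proof.
apply: (@tpair_ext _ J T F); rewrite tresM.
  by rewrite tres_pairl -[LHS](tres_pairr F x y); apply: tres_eq.
by rewrite tres_pairr -[LHS](tres_pairl F x y); apply: tres_eq.
Qed.

Lemma tpair_assoc X (x y z : T X) :
  tpair F x (tpair F y z) = tres F (hassoc X) (tpair F (tpair F x y) z).
Proof.
set w := tpair F (tpair F x y) z; apply: (@tpair_ext _ J T F); rewrite tresM.
  transitivity (tres F (hinl X X) (tres F (hinl _ _) w)).
    by rewrite !tres_pairl.
  by rewrite tresM; apply: tres_eq.
transitivity (tres F (hsummap (hinr X X) (hid X)) w); last exact: tres_eq.
by rewrite tpair_res !tres_pairr tres_id.
Qed.

Lemma tmulC X : commutative (@tmul _ J T F X).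
Proof.
by move=> x y; rewrite /tmul tpair_swap; apply: tnorm_res_bij (hswap_bij X) _; case.
Qed.

Lemma tmulA X : associative (@tmul _ J T F X).
Proof.
move=> x y z; rewrite /tmul.
pose Jf := adm_map_fold J X; pose Ji := adm_map_id J X.
rewrite -[x in LHS](tnorm_id F Ji) // -[z in RHS](tnorm_id F Ji) // !tpair_norm.
have Jl := adm_map_comp Jf (adm_summap Jf Ji).
have Jr := adm_map_comp Jf (adm_summap Ji Jf).
rewrite (tnormM _ _ _ Jl) // (tnormM _ _ _ Jr) // tpair_assoc.
by apply: tnorm_res_bij (hassoc_bij X) _; case=> [x'|[]].
Qed.

(** The unit is the norm from the empty set, and the composite of its sum with
    the identity of X and the fold map is an isomorphism onto X. *)
Lemma tmul1 X : left_id (tone F X) (@tmul _ J T F X).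
Proof.
move=> x; rewrite /tmul /tone.
pose h : gmap (hsum (hempty _) X) X := hcase (hfrom_empty X) (hid X).
pose Jf := adm_map_fold J X; pose Ji := adm_map_id J X.
pose Je := adm_map_empty J X.
have h_bij : bijective h by exists inr => [[[]|]|].
have -> : tpair F (tnorm F (adm_map_empty J X) (tpoint F)) x =
          tnorm F (adm_summap Je Ji) (tres F h x).
  rewrite -[x in LHS](tnorm_id F Ji) // tpair_norm; congr tnorm.
  apply: (@tpair_ext _ J T F); first by rewrite tres_pairl [RHS](tpointE F).
  by rewrite tres_pairr tresM tres_id.
rewrite (tnormM _ _ _ (adm_map_comp Jf (adm_summap Je Ji))) //.
rewrite -[RHS](tnorm_id F Ji) //.
by apply: tnorm_res_bij h_bij _; case.
Qed.

Section Distributivity.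
Variable X : gset gT.
Let XX : gset gT := hsum X X.

Definition dist_res : gmap (hsum XX XX) (hsum XX X) :=
  hcase (hsummap (hinl X X) (hid X)) (hsummap (hinr X X) (hid X)).

(** The exponential diagram behind (x + y) z = x z + y z.  A section over the
    fibre {inl z, inr z} of the fold map picks one of the two copies of X over
    inl z and has no choice over inr z; hence the sum over two copies of X. *)
Lemma tnorm_fold_tr (Jff : adm_map J (hsummap (hfold X) (hfold X))) u :
  tnorm F (adm_map_fold J X) (ttr F (hsummap (hfold X) (hid X)) u) =
  ttr F (hfold X) (tnorm F Jff (tres F dist_res u)).
Proof.
pose d := Bispan dist_res (hfold X : gmap XX X) Jff.
set h := hsummap (hfold X) (hid X).
transitivity (fact F d u); last first.
  rewrite -fact_resnorm; symmetry; apply: fact_comp_iso.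
  apply: (@bcomp_trivial_norm _ _ _ _ _ _ (Bispan dist_res (hid XX) Jff)
            (hid XX) (hfold X) _ d (hid XX) (hid XX) (hid _)) => //=.
  - by move=> y v <-; exists v.
  by move=> e w <-; exists w.
apply: fact_comp_iso.
(* The copy of X in which e lies is the choice made over inl z. *)
pose s (e y : XX) : option (hsum XX X) := if hfold X y == hfold X e then
  Some (match y with inl _ => inl e | inr x => inr x end) else None.
apply: (@bcomp_iso _ _ _ _ _ (bT J h) (bN (adm_map_fold J X)) d
          (hfold X) s (hfold XX) dist_res) => //=.
- move=> e y; rewrite /s; case: eqP => [|//].
  by case: y => [x|x] /= ->; split=> //; case: e.
- move=> a e y; rewrite /s !hmapP ?inE // (inj_eq (act_inj _ _)).
  by case: eqP => //; case: y.
- move=> e e' fE /(_ (inl (hfold X e))).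
  by rewrite /s /= -fE eqxx => -[].
- move=> z t tP.
  have := tP (inl z); have := tP (inr z).
  case tr: (t _) => [v|] /= [] // vE _; case tl: (t _) => [v'|] /= [] // vE' _.
  case: v' vE' tl => //= e [eE] tl; case: v vE tr => //= _ [->] tr.
  have zE : hfold X e = z by case: (e) eE.
  exists e => // y; rewrite /s zE; case: eqP => [|yE].
    by case: y => y /= ->.
  have := tP y; case: (t y) => // v [_ yE'].
  by case: yE; exact: yE'.
- by case=> [[]|[]] x; rewrite /s /= eqxx.
- by case=> [[]|[]] x [[]|[]] y //= [->].
move=> e y v; rewrite /s; case: eqP => // yE [vE].
exists (if e is inl _ then inl y else inr y).
by split; case: e y yE vE => x [] x' //= ->.
Qed.

Lemma tmulDl (x y z : T X) :
  tmul F (tadd F x y) z = tadd F (tmul F x z) (tmul F y z).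
Proof.
pose Jf := adm_map_fold J X.
rewrite /tmul /tadd -[z in LHS](ttr_id F (f := hid X)) // tpair_tr.
rewrite (tnorm_fold_tr (adm_summap Jf Jf)) tpair_norm; congr (ttr F _ (tnorm F _ _)).
set w := tpair F (tpair F x y) z.
apply: (@tpair_ext _ J T F); rewrite tresM ?tres_pairl ?tres_pairr.
  transitivity (tres F (hsummap (hinl X X) (hid X)) w); first exact: tres_eq.
  by rewrite tpair_res tres_pairl tres_id.
transitivity (tres F (hsummap (hinr X X) (hid X)) w); first exact: tres_eq.
by rewrite tpair_res tres_pairr tres_id.
Qed.
End Distributivity.

(** ** Restrictions are ring homomorphisms *)

Lemma cartesian_sum_fold X Y (f : gmap Y X) :
  cartesian (hsummap f f) (hfold Y) (hfold X) f.
Proof.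
split=> [[]//|[y|y] [y'|y'] //= _ ->//|[x|x] y /= ->].
  by exists (inl y).
by exists (inr y).
Qed.

Lemma cartesian_empty X Y (f : gmap Y X) :
  cartesian (hid _) (hfrom_empty Y) (hfrom_empty X) f.
Proof. by split=> // [[]|[]]. Qed.

Lemma tres_mul X Y (f : gmap Y X) x y :
  tres F f (tmul F x y) = tmul F (tres F f x) (tres F f y).
Proof. by rewrite /tmul -tpair_res; apply/tres_norm/cartesian_sum_fold. Qed.

Lemma tres_add X Y (f : gmap Y X) x y :
  tres F f (tadd F x y) = tadd F (tres F f x) (tres F f y).
Proof. by rewrite /tadd -tpair_res; apply/tres_tr/cartesian_sum_fold. Qed.

Lemma tres_one X Y (f : gmap Y X) : tres F f (tone F X) = tone F Y.
Proof.
rewrite /tone (tres_norm F (adm_map_empty J Y) _ _ (cartesian_empty f)).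
by congr tnorm; exact: tpointE.
Qed.

Lemma tres_zero X Y (f : gmap Y X) : tres F f (tzero F X) = tzero F Y.
Proof.
rewrite /tzero (tres_tr F _ (cartesian_empty f)).
by congr ttr; exact: tpointE.
Qed.
End Multiplication.

Section AdditiveLaws.
Variables (gT : finGroupType) (J : indexing_system gT) (T : gset gT -> Type).
Variables (F : tambara_on J T) (X : gset gT).

Lemma tmul0l : left_zero (tzero F X) (@tmul _ J T F X).
Proof.
move=> x; set z := tmul F _ x.
have zz : tadd F z z = z by rewrite -tmulDl tadd0.
by rewrite -[LHS](tadd0 F) -(taddN F z) -taddA zz.
Qed.

Lemma tmul0r : right_zero (tzero F X) (@tmul _ J T F X).
Proof. by move=> x; rewrite tmulC tmul0l. Qed.

Lemma tmulr1 : right_id (tone F X) (@tmul _ J T F X).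
Proof. by move=> x; rewrite tmulC tmul1. Qed.

Lemma tmulDr : right_distributive (@tmul _ J T F X) (@tadd _ J T F X).
Proof. by move=> x y z; rewrite ![tmul F x _]tmulC tmulDl. Qed.

HB.instance Definition _ := Monoid.isComLaw.Build (T X) (tzero F X)
  (@tadd _ J T F X) (@taddA _ J T F X) (@taddC _ J T F X) (@tadd0 _ J T F X).
HB.instance Definition _ := Monoid.isMulLaw.Build (T X) (tzero F X)
  (@tmul _ J T F X) tmul0l tmul0r.
HB.instance Definition _ := Monoid.isAddLaw.Build (T X) (@tmul _ J T F X)
  (@tadd _ J T F X) (@tmulDl _ J T F X) tmulDr.
End AdditiveLaws.

(** * Decomposition into orbits *)

Section Isomorphisms.
Variables (gT : finGroupType) (H : {group gT}).
Implicit Types X Y Z C : hset H.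

Lemma hiso_refl X : hisomorphic X X.
Proof. by exists (hid X); exists id. Qed.

Lemma hiso_trans X Y Z :
  hisomorphic X Y -> hisomorphic Y Z -> hisomorphic X Z.
Proof.
by case=> f f_bij [g g_bij]; exists (hcomp g f); exact: bij_comp.
Qed.

Lemma hiso_sum X Y X' Y' : hisomorphic X X' -> hisomorphic Y Y' ->
  hisomorphic (hsum X Y) (hsum X' Y').
Proof.
case=> f [f' fK f'K] [g [g' gK g'K]].
exists (hcase (hcomp (hinl X' Y') f) (hcomp (hinr X' Y') g)).
exists (fun u => match u with inl x => inl (f' x) | inr y => inr (g' y) end).
  by case=> u /=; rewrite ?fK ?gK.
by case=> u /=; rewrite ?f'K ?g'K.
Qed.

Lemma orbit_decomposition X (x : X) : exists2 C : hset H,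
  #|C| < #|X| & hisomorphic (hsum (hcoset H (hstab x)) C) X.
Proof.
pose O := horbit x.
have C_inv : {in H, forall a, forall y, y \notin orbit (hact X) H x ->
    hact X y a \notin orbit (hact X) H x}.
  move=> a aG y; apply: contra => /(Defs.orbit_inv (groupVr aG)).
  by rewrite hactK.
exists (hsub C_inv).
  rewrite card_sig; apply: proper_card.
  apply/properP; split; first by apply/subsetP.
  by exists x; rewrite // inE negbK orbit_refl.
pose o : O := @hsub_pt _ _ X _ (@Defs.orbit_inv _ _ X x) x (orbit_refl _ _ x).
have o_trans u : exists2 a, a \in H & u = hact O o a.
  have /imsetP[a aG uE] := valP u; exists a => //.
  by apply: val_inj; rewrite val_hsub.
have stab_o : hstab o = hstab x.
  apply/val_inj/setP=> a; apply/hstabP/hstabP=> -[aH e]; split=> //.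
    by have := congr1 val e; rewrite val_hsub.
  by apply: val_inj; rewrite val_hsub.
apply: (@hiso_trans _ (hsum O (hsub C_inv))).
  by rewrite -stab_o; exact: hiso_sum (coset_iso o_trans) (hiso_refl _).
exists (hcase (hval (@Defs.orbit_inv _ _ X x)) (hval C_inv)).
apply: inj_surj_bij => [[u|u] [v|v] /= uv|y].
- by congr inl; apply: val_inj.
- by have := valP v; rewrite /= -uv (valP u : _ \in orbit _ _ _).
- by have := valP u; rewrite /= uv (valP v : _ \in orbit _ _ _).
- by congr inr; apply: val_inj.
case: (boolP (y \in orbit (hact X) H x)) => yO.
  by exists (inl (exist _ y yO)).
by exists (inr (exist _ y yO)).
Qed.
End Isomorphisms.

(** * Morphisms of Tambara functors *)

Section Morphisms.
Variables (gT : finGroupType) (J : indexing_system gT) (S T : tambara J).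
Variable f : tmor S T.

Lemma tmor_res X Y (r : gmap Y X) x : f Y (tres S r x) = tres T r (f X x).
Proof. exact: tmorP. Qed.

Lemma tmor_pair X Y x y : f (hsum X Y) (tpair S x y) = tpair T (f X x) (f Y y).
Proof.
apply: (@tpair_ext _ J T T); rewrite -tmor_res.
  by rewrite !tres_pairl.
by rewrite !tres_pairr.
Qed.

Lemma tmor_mul X x y : f X (tmul S x y) = tmul T (f X x) (f X y).
Proof. by rewrite /tmul -tmor_pair; exact: tmorP. Qed.

Lemma tmor_bij_iso : (forall X, bijective (f X)) -> tmor_iso f.
Proof.
move=> f_bij.
have gP X : exists g, cancel (f X) g /\ cancel g (f X).
  by have [g fK gK] := f_bij X; exists g.
pose g X := projT1 (cid (gP X)).
have gK X : cancel (f X) (g X) /\ cancel (g X) (f X) := projT2 (cid (gP X)).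
have gB X W (b : bispan J X W) x : g W (fact T b x) = fact S b (g X x).
  apply: (bij_inj (f_bij W)).
  by rewrite tmorP (proj2 (gK W)) (proj2 (gK X)).
by exists (TMor gB) => X; exact: gK.
Qed.

(** ** Reduction to orbits *)

Lemma tmor_bij_hiso X Y : hisomorphic X Y -> bijective (f X) -> bijective (f Y).
Proof.
case=> i [j0 ij ji] [g fK gK].
pose j : gmap Y X := HMap (hmap_inv ij ji).
exists (fun y => tres S j (g (tres T i y))) => y.
  by rewrite -tmor_res fK tresM tres_id.
by rewrite tmor_res gK tresM tres_id.
Qed.

Lemma tmor_bij_sum X Y :
  bijective (f X) -> bijective (f Y) -> bijective (f (hsum X Y)).
Proof.
case=> g fK gK [g' fK' gK'].
exists (fun z => tpair S (g (tres T (hinl X Y) z)) (g' (tres T (hinr X Y) z))).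
  by move=> z; rewrite -!tmor_res fK fK'; exact: tpairK.
by move=> z; rewrite tmor_pair gK gK'; exact: tpairK.
Qed.

Lemma tmor_bij_empty : bijective (f (hempty _)).
Proof.
exists (fun _ => tpoint S) => z; first by rewrite (tpointE S z).
by rewrite (tpointE T z) [LHS](tpointE T).
Qed.

(** Induction on the number of points: split off one orbit. *)
Lemma tmor_bij_orbits :
  (forall H : {group gT}, bijective (f (hcoset [set: gT]%G H))) ->
  forall X, bijective (f X).
Proof.
move=> f_orb X; have [n] := ubnP #|X|; elim: n X => // n IH X leXn.
have [x _|X0] := pickP (predT : pred X); last first.
  apply: tmor_bij_hiso tmor_bij_empty; exists (hfrom_empty X).
  by apply: inj_surj_bij => [[]|x]; have := X0 x.
have [C ltCX isoX] := orbit_decomposition x.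
apply: tmor_bij_hiso isoX _; apply: tmor_bij_sum (f_orb _) _.
by apply: IH; apply: leq_trans ltCX _.
Qed.
End Morphisms.

(** * Localizing at complementary idempotents *)

(** In the ring T X, orthogonal idempotents e i of sum 1 are inverted, one by
    each f i.  The f i become the projections of a product decomposition
    because f i (e i), an invertible idempotent, is 1. *)
Section IdempotentLocalization.
Variables (gT : finGroupType) (J : indexing_system gT) (T : gset gT -> Type).
Variables (F : tambara_on J T) (X : gset gT) (I : finType) (e : I -> T X).
Variables (J' : I -> indexing_system gT) (B : forall i, tambara (J' i)).
Variable f : forall i, T X -> B i X.
Hypothesis e_idem : forall i, tmul F (e i) (e i) = e i.
Hypothesis e_orth : forall i j, i != j -> tmul F (e i) (e j) = tzero F X.
Hypothesis e_sum : \big[@tadd _ J T F X/tzero F X]_i e i = tone F X.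
Hypothesis fM : forall i x y, f i (tmul F x y) = tmul (B i) (f i x) (f i y).
Hypothesis f_loc : forall i, is_localization F (B i) (e i) (f i).

Let fe1 i : f i (e i) = tone (B i) X.
Proof.
have [[t et] _ _] := f_loc i.
by rewrite -[LHS](tmulr1 (B i)) -et tmulA -fM e_idem.
Qed.

Let fmul_e i x : f i (tmul F (e i) x) = f i x.
Proof. by rewrite fM fe1 tmul1. Qed.

Let eX i n : tmul F (e i) (texp F (e i) n) = e i.
Proof. by elim: n => [|n IH]; rewrite /= ?tmulr1 // tmulA e_idem. Qed.

(** From f i a = f i a' one gets e i a = e i a'; then sum over i. *)
Lemma localization_inj a a' : (forall i, f i a = f i a') -> a = a'.
Proof.
move=> faa'; rewrite -[a](tmul1 F) -[a'](tmul1 F) -e_sum.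
rewrite !(big_distrl (times := @tmul _ J T F X)) /=; apply: eq_bigr => i _.
have [_ _ /(_ a a')[/(_ (faa' i)) [n en] _]] := f_loc i.
by rewrite -(eX i n) -!tmulA en.
Qed.

(** If a i is a preimage of b i under f i, the sum of the e i (a i) works for
    all i at once. *)
Lemma localization_surj (b : forall i, B i X) : exists a, forall i, f i a = b i.
Proof.
have bP i : exists a, f i a = b i.
  have [_ /(_ (b i))[a [n ab]] _] := f_loc i; exists a; rewrite -ab.
  have -> : texp (B i) (f i (e i)) n = tone (B i) X.
    by elim: n {ab} => //= n ->; rewrite fe1 tmul1.
  by rewrite tmul1.
pose a i := projT1 (cid (bP i)).
have fa i : f i (a i) = b i := projT2 (cid (bP i)).
exists (\big[@tadd _ J T F X/tzero F X]_i tmul F (e i) (a i)) => i.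
rewrite -fmul_e -fa -[RHS]fmul_e; congr (f i _).
rewrite (bigD1 i) // [LHS]tmulDr.
rewrite [tmul F (e i) (tmul _ _ _)]tmulA e_idem.
rewrite big_distrr.
rewrite big1; last first.
  by move=> j ji; rewrite /= tmulA e_orth ?tmul0l // eq_sym.
rewrite taddC.
exact: tadd0.
Qed.
End IdempotentLocalization.

(** * Fixed points and isomorphism of G-sets *)

Section FixedPoints.
Variable gT : finGroupType.
Implicit Types (S X Y : gset gT) (Q : {group gT}).

Definition nfix Q S : nat := #|'Fix_(hact S)(Q)|.

Lemma nfix_le_iso Q S S' : hisomorphic S S' -> nfix Q S <= nfix Q S'.
Proof.
case=> f /bij_inj f_inj; rewrite /nfix -(card_imset (mem 'Fix_(hact S)(Q)) f_inj).
apply: subset_leq_card.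
apply/subsetP=> _ /imsetP[x /afixP xQ ->]; apply/afixP=> a aQ.
by rewrite -hmapP ?inE // xQ.
Qed.

Lemma nfix_iso Q S S' : hisomorphic S S' -> nfix Q S = nfix Q S'.
Proof.
by move=> SS'; apply/eqP; rewrite eqn_leq !nfix_le_iso //; exact: hiso_sym.
Qed.

Lemma nfix_sum Q S S' : nfix Q (hsum S S') = (nfix Q S + nfix Q S')%N.
Proof.
rewrite /nfix -!sum1_card big_sumType /=; congr addn; apply: eq_bigl => x;
  by apply/afixP/afixP=> xQ a /xQ /=; [case | move->].
Qed.

Lemma nfix_prod Q S S' : nfix Q (hprod S S') = (nfix Q S * nfix Q S')%N.
Proof.
rewrite /nfix -cardsX; congr #|pred_of_set _|; apply/setP=> -[x y].
rewrite in_setX; apply/afixP/andP=> [xyQ|[/afixP xQ /afixP yQ] a aQ].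
  by split; apply/afixP=> a aQ; have := xyQ a aQ; rewrite mkhsetE ?inE // => -[].
by rewrite mkhsetE ?inE //= xQ ?yQ.
Qed.

Lemma nfix_empty Q : nfix Q (hempty _) = 0%N.
Proof. by apply: eq_card0 => -[]. Qed.

Lemma nfix_point Q : nfix Q (hpoint _) = 1%N.
Proof.
rewrite -card_unit; apply: eq_card => x; transitivity true; last by [].
by apply/afixP.
Qed.

Lemma nfix1 S : nfix 1%G S = #|S|.
Proof.
apply: eq_card => x; transitivity true; last by [].
apply/afixP=> a /set1P->.
exact: act1.
Qed.

Lemma nfix_gt0P Q S : reflect (exists x : S, Q \subset hstab x) (0 < nfix Q S).
Proof.
apply: (iffP card_gt0P) => [[x /afixP xQ]|[x /subsetP xQ]]; exists x.
  by apply/subsetP=> a aQ; apply/hstabP; rewrite inE xQ.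
by apply/afixP=> a /xQ/hstabP[].
Qed.

(** Burnside's theorem.  Take x in S with stabilizer K as large as possible.
    Since S' has as many K-fixed points as S, some x' in S' has a stabilizer
    K' containing K; since S has as many K'-fixed points as S', some point of
    S has a stabilizer containing K', so K' = K by the choice of x.  Removing
    the isomorphic orbits of x and x' preserves the equality of fixed-point
    counts, and induction applies. *)
Theorem nfix_hiso S S' : (forall Q, nfix Q S = nfix Q S') -> hisomorphic S S'.
Proof.
have [n] := ubnP #|S|; elim: n S S' => // n IH S S' leSn eqS.
have [x0 _|S0] := pickP (predT : pred S); last first.
  have S'0 : #|S'| = 0%N by rewrite -nfix1 -eqS nfix1; apply: eq_card0.
  apply: (hiso_trans (Y := hempty _)); last first.
    exists (hfrom_empty S'); apply: inj_surj_bij => [[]|y].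
    by have := fintype0 y S'0.
  apply: hiso_sym; exists (hfrom_empty S); apply: inj_surj_bij => [[]|y].
  by have := S0 y.
have [x _ x_max] := @arg_maxnP S x0 predT (fun x => #|hstab x|) isT.
have [x' Kx'] : exists x' : S', hstab x' = hstab x.
  have /nfix_gt0P[x' sx'] : 0 < nfix (hstab x) S'.
    by rewrite -eqS; apply/nfix_gt0P; exists x.
  have /nfix_gt0P[y sy] : 0 < nfix (hstab x') S.
    by rewrite eqS; apply/nfix_gt0P; exists x'.
  exists x'; apply/val_inj/eqP; rewrite eq_sym eqEcard sx'.
  exact: leq_trans (subset_leq_card sy) (x_max y isT).
have [C ltC isoS] := orbit_decomposition x.
have [C' _ isoS'] := orbit_decomposition x'.
apply: hiso_trans (hiso_sym isoS) (hiso_trans _ isoS').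
rewrite Kx' in isoS' *; apply: hiso_sum (hiso_refl _) _.
apply: IH => [|Q]; first exact: leq_trans ltC _.
apply/eqP; rewrite -(eqn_add2l (nfix Q (hcoset _ (hstab x)))) -!nfix_sum.
by rewrite (nfix_iso Q isoS) (nfix_iso Q isoS') eqS.
Qed.
End FixedPoints.

(** * Marks on the Burnside ring *)

Section FractionMarks.
Variables (gT : finGroupType) (P : nat_pred).
Notation gpt := (hpoint [set: gT]%G : gset gT).
Implicit Types (S : gover gpt) (s t u : Defs.frac P gpt) (Q : {group gT}).
Local Open Scope ring_scope.
Import GRing.Theory Num.Theory.

Lemma nfix_omul Q n S : nfix Q (gtot (omul n S)) = (n * nfix Q (gtot S))%N.
Proof.
by elim: n => [|n IH]; [exact: nfix_empty | rewrite [LHS]nfix_sum IH mulSn].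
Qed.

Lemma over_iso_pt S S' : over_iso S S' <-> hisomorphic (gtot S) (gtot S').
Proof.
split=> [[f [f_bij _]]|[f f_bij]]; exists f => //.
by split=> // x; case: (gproj S x); case: (_ x).
Qed.

Definition fmark Q t : rat :=
  ((nfix Q (gtot (fpos t)))%:R - (nfix Q (gtot (fneg t)))%:R) / (fden t)%:R.

Lemma fden_gt0 t : (0 < fden t)%N.
Proof. by have /andP[] := fdenP t. Qed.

Lemma fden_neq0 t : (fden t)%:R != 0 :> rat.
Proof. by rewrite pnatr_eq0 -lt0n fden_gt0. Qed.

(** Cross-multiplied, equality of marks says that two G-sets have the same
    fixed-point counts, whence an isomorphism by [nfix_hiso]; conversely the
    stabilizing summand C and the factor n cancel in the counts. *)
Lemma frac_eqP s t : frac_eq s t <-> forall Q, fmark Q s = fmark Q t.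
Proof.
have cross Q : fmark Q s = fmark Q t <->
    (fden t * nfix Q (gtot (fpos s)) + fden s * nfix Q (gtot (fneg t)) =
     fden s * nfix Q (gtot (fpos t)) + fden t * nfix Q (gtot (fneg s)))%N.
  rewrite /fmark; split=> [/eqP|].
    rewrite eqr_div ?fden_neq0 // => /eqP e; apply/eqP.
    by rewrite -(eqr_nat rat) !natrD !natrM; apply/eqP; lra.
  move/(congr1 (GRing.natmul (1 : rat))); rewrite !natrD !natrM => e.
  by apply/eqP; rewrite eqr_div ?fden_neq0 //; apply/eqP; lra.
split=> [[n [C [n_nat /over_iso_pt isoC]]] Q|eq_st].
  apply/cross; have := nfix_iso Q isoC.
  rewrite [LHS]nfix_sum [RHS]nfix_sum => /addIn; rewrite !nfix_omul.
  have n_gt0 : (0 < n)%N by have /andP[] := n_nat.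
  move/eqP; rewrite eqn_pmul2l // => /eqP.
  by rewrite [LHS]nfix_sum [RHS]nfix_sum !nfix_omul.
exists 1%N, (oempty gpt); split=> //; apply/over_iso_pt/nfix_hiso => Q.
rewrite [LHS]nfix_sum [RHS]nfix_sum !nfix_omul; congr (_ * _ + _)%N.
by rewrite [LHS]nfix_sum [RHS]nfix_sum !nfix_omul; apply/cross.
Qed.

Definition rep (x : burnside P gpt) : Defs.frac P gpt := projT1 (cid (svalP x)).

Lemma bfrac_eqP s t : bfrac s = bfrac t <-> forall Q, fmark Q s = fmark Q t.
Proof.
split=> [/(congr1 sval) /= e|e]; first by apply/frac_eqP; rewrite e; apply/frac_eqP.
have fe : frac_eq s = frac_eq t.
  by apply: funext => u; apply: propext; split=> /frac_eqP eu; apply/frac_eqP=> Q;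
    rewrite -eu e.
exact: eq_exist.
Qed.

Lemma repK x : bfrac (rep x) = x.
Proof.
move: (projT2 (cid (svalP x)) : sval x = frac_eq (rep x)).
by case: x => c cP /= cE; apply: eq_exist.
Qed.

Definition mark Q (x : burnside P gpt) : rat := fmark Q (rep x).

Lemma mark_bfrac Q t : mark Q (bfrac t) = fmark Q t.
Proof. by move: Q; apply/bfrac_eqP; exact: repK. Qed.

Lemma mark_bset Q S : mark Q (bset P S) = (nfix Q (gtot S))%:R.
Proof. by rewrite mark_bfrac /fmark /= nfix_empty subr0 divr1. Qed.

Lemma mark_inj x y : (forall Q, mark Q x = mark Q y) -> x = y.
Proof. by move=> e; rewrite -(repK x) -(repK y); apply/bfrac_eqP. Qed.

Variable A : burnside_tambara gT P.

Lemma mark_add Q x y : mark Q (tadd A x y) = mark Q x + mark Q y.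
Proof.
rewrite -(repK x) -(repK y); move: (rep x) (rep y) => s t.
rewrite bt_add !mark_bfrac /fmark /frac_add /=.
rewrite ![nfix _ (hsum _ _)]nfix_sum !nfix_omul !natrD !natrM.
by field; rewrite !fden_neq0.
Qed.

Lemma mark_one Q : mark Q (tone A gpt) = 1.
Proof.
(* The one element over the empty set is the class of the empty G-set, whose
   norm is a point. *)
rewrite /tone -(tpointE A (bset P (oempty (hempty _)))) bt_norm mark_bset.
set D := odprod _ _; suff isoD : hisomorphic (gtot D) gpt.
  by rewrite (nfix_iso Q isoD) nfix_point.
exists (hto_point _); apply: inj_surj_bij => [[[[] s] sP] [[[] s'] sP'] _|[]].
  by apply: val_inj; congr pair; apply/ffunP=> -[].
pose s : hsec (hempty _) (hempty [set: gT]%G) := [ffun _ => None].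
have sP : is_section (hfrom_empty gpt) (gproj (oempty (hempty _))) (tt : gpt, s).
  by apply/forallP=> -[].
by exists (exist _ (tt, s) sP).
Qed.

Definition opair S S' : gover (hsum gpt gpt) :=
  GOver (hcase (hcomp (hinl gpt gpt) (gproj S)) (hcomp (hinr gpt gpt) (gproj S'))).

(** The fibre of the fold map of the point has two elements, so a section is
    a pair of points: the norm along the fold map is the cartesian product. *)
Lemma odprod_fold S S' :
  hisomorphic (hprod (gtot S) (gtot S'))
    (gtot (odprod (hfold gpt) (opair S S'))).
Proof.
set U := opair S S'; set D := odprod _ _.
pose sec (p : hprod (gtot S) (gtot S')) : hsec (gtot U) (hsum gpt gpt) :=
  [ffun y => Some (if y is inl _ then inl p.1 else inr p.2)].
have secP p : is_section (hfold gpt) (gproj U) (tt : gpt, sec p).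
  by apply/forallP=> -[[]|[]]; rewrite /= ffunE.
pose f p : gtot D := exist _ (tt : gpt, sec p) (secP p).
have fP : {in [set: gT]%G, forall a, forall p,
    f (hact (hprod (gtot S) (gtot S')) p a) = hact (gtot D) (f p) a}.
  move=> a aG p; apply: val_inj; rewrite [RHS]val_hsub //.
  rewrite [RHS]mkhsetE //; congr pair; rewrite [RHS]mkhsetE //.
  by apply/ffunP=> y; rewrite !ffunE mkhsetE //; case: y.
exists (HMap fP); apply: inj_surj_bij => [p p' /(congr1 val)[/ffunP e]|].
  move: (e (inl tt)) (e (inr tt)); rewrite !ffunE => -[e1] [e2].
  by rewrite [p]surjective_pairing e1 e2 -surjective_pairing.
case=> -[[] t] tP; have /forallP /= tP' := tP.
move: (tP' (inl tt)) (tP' (inr tt)).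
case tl: (t (inl tt)) => [[x|x]|] //= _.
case tr: (t (inr tt)) => [[y|y]|] //= _.
exists (x, y); apply: val_inj => /=; congr pair; apply/ffunP=> -[[]|[]];
  by rewrite ffunE ?tl ?tr.
Qed.

Lemma opull_inl S S' :
  hisomorphic (gtot S) (gtot (opull (hinl gpt gpt) (opair S S'))).
Proof.
have fP x : hinl gpt gpt (gproj S x) == gproj (opair S S') (inl x) by [].
pose f x : gtot (opull (hinl gpt gpt) (opair S S')) :=
  exist _ (gproj S x, inl x) (fP x).
have fA : {in [set: gT]%G, forall a, forall x, f (hact _ x a) = hact _ (f x) a}.
  by move=> a aG x; apply: val_inj; rewrite [RHS]val_pull_act // [LHS]/= hmapP.
exists (HMap fA); apply: inj_surj_bij => [x x' /(congr1 val) [] //|].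
case=> -[[] [x|x]] // xP; exists x; apply: val_inj => /=.
by case: (gproj S x).
Qed.

Lemma opull_inr S S' :
  hisomorphic (gtot S') (gtot (opull (hinr gpt gpt) (opair S S'))).
Proof.
have fP x : hinr gpt gpt (gproj S' x) == gproj (opair S S') (inr x) by [].
pose f x : gtot (opull (hinr gpt gpt) (opair S S')) :=
  exist _ (gproj S' x, inr x) (fP x).
have fA : {in [set: gT]%G, forall a, forall x, f (hact _ x a) = hact _ (f x) a}.
  by move=> a aG x; apply: val_inj; rewrite [RHS]val_pull_act // [LHS]/= hmapP.
exists (HMap fA); apply: inj_surj_bij => [x x' /(congr1 val) [] //|].
case=> -[[] [x|x]] // xP; exists x; apply: val_inj => /=.
by case: (gproj S' x).
Qed.

Lemma mark_mul_bset Q S S' :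
  mark Q (tmul A (bset P S) (bset P S')) =
  mark Q (bset P S) * mark Q (bset P S').
Proof.
have -> : tmul A (bset P S) (bset P S') = bset P (odprod (hfold gpt) (opair S S')).
  rewrite -(bt_norm A (adm_map_fold (complete_system gT) gpt)); congr tnorm.
  apply: (@tpair_ext _ _ _ A).
    rewrite tres_pairl bt_res; apply: mark_inj => Q'; rewrite !mark_bset.
    by rewrite (nfix_iso _ (opull_inl S S')).
  rewrite tres_pairr bt_res; apply: mark_inj => Q'; rewrite !mark_bset.
  by rewrite (nfix_iso _ (opull_inr S S')).
by rewrite !mark_bset -natrM -(nfix_iso Q (odprod_fold S S')) nfix_prod.
Qed.

Section AdditiveFunctions.
Variable g : burnside P gpt -> rat.
Hypothesis gD : {morph g : x y / tadd A x y >-> x + y}.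

Lemma additive_zero : g (tzero A gpt) = 0.
Proof.
have := gD (tzero A gpt) (tzero A gpt); rewrite tadd0.
by move/eqP; rewrite -subr_eq0 opprD addNKr oppr_eq0 => /eqP.
Qed.

Lemma additive_iter n x : g (iter n (tadd A x) (tzero A gpt)) = g x *+ n.
Proof. by elim: n => [|n IH]; rewrite ?additive_zero // iterS gD IH mulrS. Qed.
End AdditiveFunctions.

Lemma mark_zero Q : mark Q (tzero A gpt) = 0.
Proof. exact: additive_zero (mark_add Q). Qed.

Lemma bset_fractions x : exists n S S', (0 < n)%N /\
  tadd A (iter n (tadd A x) (tzero A gpt)) (bset P S') = bset P S.
Proof.
exists (fden (rep x)), (fpos (rep x)), (fneg (rep x)); split; first exact: fden_gt0.
apply: mark_inj => Q; rewrite mark_add (additive_iter (mark_add Q)) !mark_bset.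
by rewrite -[mark Q x *+ _]mulr_natr divfK ?fden_neq0 // subrK.
Qed.

(** The target being torsion-free, the equation n x + [S'] = [S] determines
    the value at x. *)
Lemma additive_ext (g h : burnside P gpt -> rat) :
    {morph g : x y / tadd A x y >-> x + y} ->
    {morph h : x y / tadd A x y >-> x + y} ->
  (forall S, g (bset P S) = h (bset P S)) -> g =1 h.
Proof.
move=> gD hD gh x; have [n [S [S' [n_gt0 xE]]]] := bset_fractions x.
have fracE (k : burnside P gpt -> rat) : {morph k : x y / tadd A x y >-> x + y} ->
    k (bset P S) = k x *+ n + k (bset P S').
  by move=> kD; rewrite -xE kD additive_iter.
have /addIr/eqP : g x *+ n + g (bset P S') = h x *+ n + g (bset P S').
  by rewrite -fracE // {1}gh [in RHS]gh -fracE.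
by rewrite eqr_pMn2r // => /eqP.
Qed.

(** Both sides are additive in x and in y, so classes of G-sets suffice. *)
Lemma mark_mul Q x y : mark Q (tmul A x y) = mark Q x * mark Q y.
Proof.
move: x; apply: additive_ext => [z w|z w|S].
- by rewrite tmulDl mark_add.
- by rewrite mark_add mulrDl.
rewrite tmulC mulrC; move: y; apply: additive_ext => [z w|z w|S'].
- by rewrite tmulDl mark_add.
- by rewrite mark_add mulrDl.
exact: mark_mul_bset.
Qed.

Lemma mark_is_mark Q : is_mark A Q (mark Q).
Proof.
split=> [|||S]; first exact: mark_one.
- exact: mark_add.
- exact: mark_mul.
exact: mark_bset.
Qed.

End FractionMarks.

(** * Solvable residuals *)

Section SolvableResidual.
Variables (gT : finGroupType) (P : nat_pred).
Implicit Types (N O Q L : {group gT}).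
Notation residual := (solv_residual P).

Lemma solv_pgroup_quotientJ N O x : x \in 'N(O) -> N <| O ->
    solvable (O / N) -> P.-group (O / N) ->
  [/\ (N :^ x)%G <| O, solvable (O / (N :^ x)%G) & P.-group (O / (N :^ x)%G)].
Proof.
move=> xO nN solN pN; have Ox := normP xO.
have nNx : (N :^ x)%G <| O by rewrite -Ox normalJ.
split=> //.
  (* Solvability of O / N says that N contains a term of the derived series
     of O, and these terms are characteristic. *)
  have [n derN] := derivedP _ solN; apply/derivedP; exists n; apply/trivgP.
  rewrite /= -quotient_der ?normal_norm // quotient_sub1; last first.
    exact: subset_trans (der_sub n O) (normal_norm nNx).
  rewrite -(normP (subsetP (char_norms (der_char n O)) x xO)) conjSg.
  rewrite -quotient_sub1; last exact: subset_trans (der_sub n O) (normal_norm nN).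
  by rewrite quotient_der ?normal_norm //; apply/trivgP.
move: pN; rewrite /pgroup !card_quotient ?normal_norm //.
by rewrite -!divgS ?normal_sub //= cardJg.
Qed.

(** Conjugation by an element normalizing O permutes the normal subgroups of O
    with solvable P-quotient, hence fixes the least one. *)
Lemma solv_residual_norm O : 'N(O) \subset 'N(residual O).
Proof.
apply/subsetP=> x xO; rewrite inE.
have [nN solN pN min] := solv_residualP P O.
have [nNx solNx pNx] := solv_pgroup_quotientJ (groupVr xO) nN solN pN.
by rewrite sub_conjg; exact: min nNx solNx pNx.
Qed.

(** Put O = O^P(Q) and N = O^P(O).  Then N is normal in Q and Q/N is an
    extension of Q/O by O/N, again a solvable P-group; so O is contained in N
    by minimality of O. *)
Lemma solv_residual_idem Q : residual (residual Q) = residual Q.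
Proof.
set O := residual Q; have [nO solO pO minO] := solv_residualP P Q.
have [nN solN pN _] := solv_residualP P O.
have nNQ : residual O <| Q.
  rewrite /normal (subset_trans (normal_sub nN) (normal_sub nO)) /=.
  exact: subset_trans (normal_norm nO) (solv_residual_norm O).
have nON : O / residual O <| Q / residual O by exact: quotient_normal.
have i3 := third_isog (normal_sub nN) nNQ nO.
apply/val_inj/eqP; rewrite eqEsubset normal_sub //=.
apply: minO => //.
  by rewrite (series_sol nON) solN (isog_sol i3).
by rewrite -(pquotient_pgroup pN) ?normal_norm // (isog_pgroup _ i3).
Qed.

HB.instance Definition _ := Finite.copy (perfect_class gT P)
  {C : {set {group gT}} | [exists L : {group gT},
    is_perfect P L && (C == orbit 'JG [set: gT] L)]}.

Implicit Types C D : perfect_class gT P.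

Fact perfect_orbit Q : [exists L : {group gT}, is_perfect P L &&
  (orbit 'JG [set: gT] (residual Q) == orbit 'JG [set: gT] L)].
Proof.
by apply/existsP; exists (residual Q); rewrite eqxx andbT /is_perfect
  solv_residual_idem.
Qed.

Definition residual_class Q : perfect_class gT P :=
  exist (fun C : {set {group gT}} => [exists L : {group gT},
    is_perfect P L && (C == orbit 'JG [set: gT] L)]) _ (perfect_orbit Q).

Lemma perfect_class_eq C L : L \in val C -> val C = orbit 'JG [set: gT] L.
Proof.
case: C => C /= /existsP[L0 /andP[_ /eqP ->]] LC.
exact/esym/orbit_eqP.
Qed.

Lemma residual_classP C Q : (residual Q \in val C) = (C == residual_class Q).
Proof.
apply/idP/eqP=> [QC|->]; last exact: orbit_refl.
by apply: val_inj; rewrite (perfect_class_eq QC).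
Qed.

End SolvableResidual.

(** * The splitting *)

Section Splitting.
Variables (gT : finGroupType) (P : nat_pred) (A : burnside_tambara gT P).
Variable e : perfect_class gT P -> burnside P (hpoint [set: gT]%G).
Hypothesis he : forall C, is_dress_idempotent A C (e C).
Notation gpt := (hpoint [set: gT]%G : gset gT).

Let mark_e Q C : mark Q (e C) = (C == residual_class P Q)%:R%R.
Proof. by rewrite (he C (mark_is_mark A Q)) residual_classP. Qed.

Lemma dress_idem C : tmul A (e C) (e C) = e C.
Proof.
by apply: mark_inj => Q; rewrite mark_mul mark_e; case: eqP.
Qed.

Lemma dress_orth C D : C != D -> tmul A (e C) (e D) = tzero A gpt.
Proof.
move=> CD; apply: mark_inj => Q; rewrite mark_mul mark_zero !mark_e.
case: (C =P residual_class P Q) CD => [-> CD|_ _]; last by rewrite GRing.mul0r.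
by rewrite [D == _]eq_sym (negPf CD) GRing.mulr0.
Qed.

Lemma dress_sum : \big[@tadd _ _ _ A gpt/tzero A gpt]_C e C = tone A gpt.
Proof.
apply: mark_inj => Q; rewrite mark_one.
rewrite (big_morph (mark Q) (mark_add A Q) (mark_zero A Q)).
rewrite (bigD1 (residual_class P Q)) //= mark_e eqxx big1 ?GRing.addr0 //.
by move=> C /negPf CQ; rewrite mark_e CQ.
Qed.

Variable B : forall C : perfect_class gT P, localization_tambara A C (e C).

Lemma loc_map_mul C X x y :
  loc_map (B C) X (tmul A x y) = tmul (B C) (loc_map (B C) X x) (loc_map (B C) X y).
Proof.
rewrite -(tmor_mul (loc_map (B C))); congr (loc_map (B C) X _).
by apply: fact_iso; exact: same_bispan_iso.
Qed.

Lemma localization_maps_orbit (H : {group gT}) :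
  bijective (localization_maps B (hcoset [set: gT]%G H)).
Proof.
pose GH : gset gT := hcoset [set: gT]%G H.
pose r x := tres A (hto_point GH : gmap GH gpt) x.
pose eH (C : perfect_class gT P) := r (e C).
pose f (C : perfect_class gT P) := loc_map (B C) GH.
have e_idem C : tmul A (eH C) (eH C) = eH C.
  by rewrite -(tres_mul A) dress_idem.
have e_orth C D : C != D -> tmul A (eH C) (eH D) = tzero A GH.
  by move=> CD; rewrite -(tres_mul A) dress_orth // tres_zero.
have e_sum : \big[@tadd _ _ _ A GH/tzero A GH]_C eH C = tone A GH.
  rewrite -(tres_one A (hto_point GH : gmap GH gpt)) -dress_sum.
  rewrite (big_morph _ (tres_add A (hto_point GH : gmap GH gpt))
                       (tres_zero A (hto_point GH : gmap GH gpt))).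
  by [].
have f_loc C : is_localization A (B C) (eH C) (f C) := loc_mapP (B C) H.
have fM C : {morph f C : x y / tmul A x y >-> tmul (B C) x y} := @loc_map_mul C GH.
have inj := localization_inj e_idem e_sum f_loc.
have surj := localization_surj e_idem e_orth fM f_loc.
pose g b := projT1 (cid (surj b)).
have gK b : forall C, f C (g b) = b C := projT2 (cid (surj b)).
exists g => [a|b]; first by apply: inj => C; rewrite gK.
by apply: functional_extensionality_dep => C; exact: gK.
Qed.
End Splitting.

Theorem corollary4p24 (gT : finGroupType) (P : nat_pred)
    (A : burnside_tambara gT P)
    (e : perfect_class gT P -> burnside P (hpoint [set: gT]%G))
    (he : forall C : perfect_class gT P, is_dress_idempotent A C (e C))
    (B : forall C : perfect_class gT P, localization_tambara A C (e C)) :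
  tmor_iso (localization_maps B).
Proof.
by apply: tmor_bij_iso; apply: tmor_bij_orbits; exact: localization_maps_orbit.
Qed.
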